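(* Let $p$ be a prime number, $F$ a field, $X$ an indeterminate over $F$, $D_n=F[X^{\frac{1}{p^n}},X^{-\frac{1}{p^n}}]$ for each $n\in\mathbb{N}_0$ and $D=\bigcup_{n\in\mathbb{N}_0}D_n$. Then the following statements are satisfied. (1) $D$ is a Bézout domain of Krull dimension one. (2) $D$ is not a Dedekind domain. (3) If $M$ is a maximal ideal of $D$ such that $D/M$ is finite, then $F$ is finite and $M$ is not a principal ideal of $D$. (4) $\dim(D[[Y]])\ge 2^{\aleph_1}$, where $D[[Y]]$ is the power series ring in one indeterminate $Y$ over $D$, and equality holds under the continuum hypothesis if $F$ is countable.
   Context: $\mathbb{N}_0$ is the set of nonnegative integers. The elements $X^{1/p^n}$ are compatible roots of $X$, i.e. $(X^{1/p^{n+1}})^p=X^{1/p^n}$, so $D_n\subsetneq D_{n+1}$ and $D$ is the group ring $F[X;G]$ with $G=\mathbb{Z}[1/p]$. A Bézout domain is an integral domain whose finitely generated ideals are principal. The length of a chain $\mathcal{C}$ of prime ideals (a nonempty totally ordered set of primes) is $|\mathcal{C}|-1$. The Krull dimension $\dim A$ is the largest cardinal $\alpha$ (if any) such that there is a chain of prime ideals of $A$ of length $\alpha$; $\dim A\ge\alpha$ means that there is a chain of prime ideals of $A$ of length $\ge\alpha$. *)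

(* Defs.v *)
From HB Require Import structures.
From mathcomp Require Import all_boot all_order all_algebra.
From mathcomp Require Import all_classical.

Set Implicit Arguments.
Unset Strict Implicit.
Unset Printing Implicit Defensive.

Import GRing.Theory.
Local Open Scope classical_set_scope.
Local Open Scope card_scope.
Local Open Scope ring_scope.

Section Ideals.
Variable A : comNzRingType.
Implicit Types (I P M : {pred A}) (s : seq A).

(* Unlike the library's idealr_closed, this allows the unit ideal. *)
Definition is_ideal I : Prop :=
  0 \in I /\ forall a : A, {in I &, forall u v, a * u + v \in I}.

Definition prime_ideal P : Prop := idealr_closed P /\ prime_idealr_closed P.

Definition maximal_ideal M : Prop :=
  idealr_closed M /\
  forall I, idealr_closed I -> {subset M <= I} -> {subset I <= M}.

Definition generated_by s : set A :=
  [set x | exists c : 'I_(size s) -> A, x = \sum_(i < size s) c i * s`_i].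

Definition finitely_generated I : Prop :=
  exists s, [set` I] = generated_by s.

Definition principal I : Prop :=
  exists a : A, [set` I] = generated_by [:: a].

Definition noetherian : Prop :=
  forall I, is_ideal I -> finitely_generated I.

End Ideals.

Definition bezout_domain (A : idomainType) : Prop :=
  forall I : {pred A}, is_ideal I -> finitely_generated I -> principal I.

Definition integrally_closed (A : idomainType) : Prop :=
  forall u : {fraction A}, integralOver (@tofrac A) u -> exists a : A, u = tofrac a.

(* Fields are allowed here; a field is often counted as a Dedekind domain. *)
Definition dedekind_domain (A : idomainType) : Prop :=
  [/\ noetherian A, integrally_closed A &
      forall P : {pred A}, prime_ideal P ->
        (exists2 x : A, x \in P & x != 0) -> maximal_ideal P].

Section KrullDimension.
Variable A : comNzRingType.

(* A cardinal is given as the cardinality of a set in an arbitrary type. *)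

Definition prime_chain (C : set (pred A)) : Prop :=
  [/\ C !=set0, forall P, C P -> prime_ideal P &
      forall P Q, C P -> C Q -> {subset P <= Q} \/ {subset Q <= P}].

(* The length |C| - 1 is the cardinality of C with one member removed, and
   does not depend on the member. *)
Definition chain_length (C : set (pred A)) (T : Type) (alpha : set T) : Prop :=
  exists2 P, C P & (C `\ P) #= alpha.

Definition krull_dim_ge (T : Type) (alpha : set T) : Prop :=
  exists2 C, prime_chain C &
    exists (U : Type) (beta : set U), chain_length C beta /\ alpha #<= beta.

Definition krull_dim_eq (T : Type) (alpha : set T) : Prop :=
  (exists2 C, prime_chain C & chain_length C alpha) /\
  (forall C (U : Type) (beta : set U),
     prime_chain C -> chain_length C beta -> beta #<= alpha).

End KrullDimension.

(* W has cardinality aleph_1, the least uncountable cardinal. *)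
Definition card_aleph1 (W : Type) : Prop :=
  ~ countable [set: W] /\
  forall B : set W, countable B \/ B #= [set: W].

Definition continuum_hypothesis : Prop := card_aleph1 (set nat).

(* A[[Y]]: a power series is its sequence of coefficients. *)
Section PowerSeries.
Variable A : comNzRingType.

Record power_series := PowerSeries { series_coef : nat -> A }.

HB.instance Definition _ := [isNew for series_coef].
HB.instance Definition _ := [Choice of power_series by <:].

Implicit Types f g h : power_series.

Lemma power_seriesP f g : series_coef f =1 series_coef g -> f = g.
Proof. by case: f g => [f] [g] /= /funext ->. Qed.

Definition series_zero := PowerSeries (fun=> 0).
Definition series_opp f := PowerSeries (fun n => - series_coef f n).
Definition series_add f g :=
  PowerSeries (fun n => series_coef f n + series_coef g n).
Definition series_one := PowerSeries (fun n => (n == 0%N)%:R).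
Definition series_mul f g :=
  PowerSeries (fun n => \sum_(i < n.+1) series_coef f i * series_coef g (n - i)).

Fact series_addA : associative series_add.
Proof. by move=> f g h; apply: power_seriesP => n /=; rewrite addrA. Qed.
Fact series_addC : commutative series_add.
Proof. by move=> f g; apply: power_seriesP => n /=; rewrite addrC. Qed.
Fact series_add0 : left_id series_zero series_add.
Proof. by move=> f; apply: power_seriesP => n /=; rewrite add0r. Qed.
Fact series_addN : left_inverse series_zero series_opp series_add.
Proof. by move=> f; apply: power_seriesP => n /=; rewrite addNr. Qed.

HB.instance Definition _ := GRing.isZmodule.Build power_series
  series_addA series_addC series_add0 series_addN.

Let trunc N f : {poly A} := \poly_(i < N) series_coef f i.

Let truncE N f i : (i < N)%N -> (trunc N f)`_i = series_coef f i.
Proof. by move=> iN; rewrite coef_poly iN. Qed.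

Let mulE N f g i : (i < N)%N ->
  series_coef (series_mul f g) i = (trunc N f * trunc N g)`_i.
Proof.
move=> iN; rewrite coefM /=; apply: eq_bigr => j _.
by rewrite !truncE ?(leq_ltn_trans (leq_subr _ _) iN) //
           (leq_ltn_trans _ iN) // -ltnS.
Qed.

Fact series_mulC : commutative series_mul.
Proof.
by move=> f g; apply: power_seriesP => n; rewrite !(mulE _ _ (ltnSn n)) mulrC.
Qed.

Fact series_mulA : associative series_mul.
Proof.
move=> f g h; apply: power_seriesP => n.
have le_n (i : 'I_n.+1) : (n - i < n.+1)%N by rewrite ltnS leq_subr.
transitivity ((trunc n.+1 f * (trunc n.+1 g * trunc n.+1 h))`_n).
  rewrite coefM {1}/series_mul [LHS]/=; apply: eq_bigr => i _.
  by rewrite truncE // -mulE.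
rewrite mulrA coefM {1}/series_mul [RHS]/=; apply: eq_bigr => i _.
by rewrite truncE // -mulE.
Qed.

Fact series_mul1 : left_id series_one series_mul.
Proof.
move=> f; apply: power_seriesP => n /=.
rewrite big_ord_recl /= mul1r subn0 big1 ?addr0 // => i _.
by rewrite mul0r.
Qed.

Fact series_mulD : left_distributive series_mul series_add.
Proof.
move=> f g h; apply: power_seriesP => n /=.
by rewrite -big_split; apply: eq_bigr => i _; rewrite mulrDl.
Qed.

Fact series_one_neq0 : series_one != 0.
Proof.
by apply/eqP => /(congr1 (fun f => series_coef f 0)) /= /eqP; rewrite oner_eq0.
Qed.

HB.instance Definition _ := GRing.Zmodule_isComNzRing.Build power_series
  series_mulA series_mulC series_mul1 series_mulD series_one_neq0.

End PowerSeries.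

(* X n plays the role of X^(1/p^n) in a field L containing F. *)
Record compatible_roots (p : nat) (F L : fieldType) (iota : {rmorphism F -> L})
    (X : nat -> L) : Prop := CompatibleRoots {
  roots_transcendental : ~ algebraicOver iota (X 0%N);
  roots_compatible : forall n, X n.+1 ^+ p = X n
}.

(* D_n = F[X n, (X n)^-1] as a subset of L. *)
Definition laurent_subring (F L : fieldType) (iota : {rmorphism F -> L})
    (X : nat -> L) (n : nat) : set L :=
  [set z | exists (f : {poly F}) (k : nat),
             z = (map_poly iota f).[X n] / X n ^+ k].

Section RootRing.
Variables (p : nat) (F L : fieldType) (iota : {rmorphism F -> L}).
Variables (X : nat -> L) (hX : compatible_roots p iota X).

Definition root_subring of compatible_roots p iota X : {pred L} :=
  fun z => z \in \bigcup_(n in [set: nat]) laurent_subring iota X n.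

Let Dn := laurent_subring iota X.

Let X_neq0 n : X n != 0.
Proof.
have X0 : X 0%N != 0.
  apply/eqP => X00; apply: (roots_transcendental hX); rewrite X00.
  by exists 'X; rewrite ?polyX_eq0 // map_polyX rootX.
elim: n => // n; rewrite -(roots_compatible hX); apply: contraNN => /eqP Xn1.
have p_gt0 : (0 < p)%N.
  case: posnP => // p0; case: (roots_transcendental hX).
  rewrite -(roots_compatible hX) p0 expr0.
  exists ('X - 1); first by rewrite polyXsubC_eq0.
  by rewrite rmorphB /= map_polyX rmorph1 root_XsubC.
by rewrite Xn1 expr0n eqn0Ngt p_gt0.
Qed.

Let DnS n : Dn n `<=` Dn n.+1.
Proof.
move=> _ [f [k ->]]; exists (f \Po 'X^p), (p * k)%N.
by rewrite map_comp_poly map_polyXn horner_comp hornerXn exprM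
           (roots_compatible hX).
Qed.

Let Dn_mono m n : (m <= n)%N -> Dn m `<=` Dn n.
Proof.
move=> /subnK <-; elim: (n - m)%N => // k IH.
by rewrite addSn; apply: subset_trans IH (@DnS _).
Qed.

Fact root_subring_closed : subring_closed (root_subring hX).
Proof.
have inD n z : Dn n z -> z \in root_subring hX.
  by move=> Dz; apply/mem_set; exists n.
have common u v : u \in root_subring hX -> v \in root_subring hX ->
    exists n, Dn n u /\ Dn n v.
  move=> /set_mem[m _ Du] /set_mem[n _ Dv]; exists (maxn m n).
  by split; [apply: Dn_mono Du | apply: Dn_mono Dv];
    rewrite ?leq_maxl ?leq_maxr.
split=> [|u v /common/[apply]|u v /common/[apply]].
- by apply: (inD 0%N); exists 1, 0%N; rewrite rmorph1 hornerC divr1.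
- case=> n [[f [k ->]] [g [l ->]]]; apply: (inD n).
  exists (f * 'X^l - g * 'X^k), (k + l)%N.
  rewrite rmorphB !rmorphM /= !map_polyXn hornerD hornerN !hornerM !hornerXn.
  by rewrite exprD -[X in _ + X = _]mulNr addf_div ?expf_neq0 // mulNr.
- case=> n [[f [k ->]] [g [l ->]]]; apply: (inD n).
  by exists (f * g), (k + l)%N; rewrite rmorphM hornerM exprD mulf_div.
Qed.

HB.instance Definition _ :=
  GRing.isSubringClosed.Build L (root_subring hX) root_subring_closed.

(* D, the union of the D_n. *)
Record root_ring := RootRing {
  root_ring_val : L;
  _ : root_ring_val \in root_subring hX
}.

HB.instance Definition _ := [isSub for root_ring_val].
HB.instance Definition _ := [Choice of root_ring by <:].
HB.instance Definition _ := [SubChoice_isSubComNzRing of root_ring by <:].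

Definition root_ring_unit : pred root_ring :=
  fun z => (val z != 0) && ((val z)^-1 \in root_subring hX).
Definition root_ring_inv (z : root_ring) : root_ring :=
  if root_ring_unit z then insubd z (val z)^-1 else z.

Fact root_ring_mulVr : {in root_ring_unit, left_inverse 1 root_ring_inv *%R}.
Proof.
move=> z /[dup] Uz /andP[z0 Dz]; apply: val_inj.
have Ez: val (root_ring_inv z) = (val z)^-1.
  by rewrite /root_ring_inv (Uz : root_ring_unit z = true) insubdK.
by rewrite rmorphM rmorph1 /= Ez mulVf.
Qed.

Fact root_ring_unitP (x y : root_ring) : y * x = 1 -> root_ring_unit x.
Proof.
move=> /(congr1 val); rewrite rmorphM rmorph1 /= => yx1.
have x0 : val x != 0 by apply: contra_eq_neq yx1 => ->; rewrite mulr0 eq_sym oner_eq0.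
by rewrite /root_ring_unit x0 -[_^-1]mul1r -yx1 mulfK //; apply: valP.
Qed.

Fact root_ring_inv_out : {in [predC root_ring_unit], root_ring_inv =1 id}.
Proof.
move=> z /negPf nUz.
by rewrite /root_ring_inv (nUz : root_ring_unit z = false).
Qed.

HB.instance Definition _ := GRing.ComNzRing_hasMulInverse.Build root_ring
  root_ring_mulVr root_ring_unitP root_ring_inv_out.

Fact root_ring_integral : GRing.integral_domain_axiom root_ring.
Proof.
move=> x y /(congr1 val)/eqP; rewrite rmorphM rmorph0 /= mulf_eq0.
by rewrite -!(inj_eq val_inj).
Qed.

HB.instance Definition _ :=
  GRing.ComUnitRing_isIntegral.Build root_ring root_ring_integral.

End RootRing.

(* Main.v *)
(* Every element of D is, up to a power of X^(1/p^n), a polynomial in some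
   X^(1/p^n), so D inherits Bezout identities and one-dimensionality from F[T].
   Degrees normalised by p^(-n) are monotone for divisibility and take
   arbitrarily small positive values on nonunits: hence the ideal of all
   X^(1/p^n) - 1 is not finitely generated, and a principal maximal ideal has an
   infinite residue field.

   For the power series ring, a sequence of valuations v_k of D extends to
   valuations of D[[Y]] giving Y the value 1. Along a free ultrafilter, the series
   whose value grows at least like a multiple of h(k) form a prime ideal, for every
   unbounded h. The series sum_n b_(m(n)) Y^n, where v_k(b_j) jumps from large to
   small values between j = k and j = k + 1, realise every slow growth rate h, and
   between two countable families of growth rates there is always another one.
   Transfinite recursion along aleph_1 thus embeds a binary tree of height aleph_1,
   whose 2^aleph_1 branches give a chain of prime ideals. *)
Require Import Defs.
From HB Require Import structures.
From mathcomp Require Import all_boot all_order all_algebra.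
From mathcomp Require Import all_classical.
From mathcomp Require wochoice.
From mathcomp Require Import zify lra.

Set Implicit Arguments.
Unset Strict Implicit.
Unset Printing Implicit Defensive.

Import Order.TTheory GRing.Theory Num.Theory.
Local Open Scope classical_set_scope.
Local Open Scope card_scope.

(** * Growth rates *)

(** This is g = o(h) without division. A function is slower than itself exactly when it is
    eventually zero; the constant 1 kept below every rate rules such functions out. *)
Definition slower (g h : nat -> nat) : Prop :=
  forall N, exists K, forall k, K <= k -> N * g k <= h k.

(** A diagonal argument. Let r(k) be the largest n <= k such that n^2 a_i <= b_j from k on for all
    i, j <= n. Then r tends to infinity, c = r * max_(i <= r) a_i outgrows each a_i, and r * c is
    eventually below each b_j. *)
Lemma slower_between_seq (a b : nat -> nat -> nat) :
    (forall i, {homo a i : m n / m <= n}) ->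
    (forall i j, slower (a i) (b j)) ->
  exists2 c, {homo c : m n / m <= n} & forall i, slower (a i) c /\ slower c (b i).
Proof.
move=> mon_a ab.
pose Q n k := forall k', k <= k' ->
  forall i j, i <= n -> j <= n -> n * n * a i k' <= b j k'.
have Q0 k : Q 0 k by move=> ? _ ? ?; rewrite !mul0n.
have QS n k k' : k <= k' -> Q n k -> Q n k'.
  by move=> kk' Qk l k'l; apply: Qk; apply: leq_trans k'l.
have QE n : exists k, Q n k.
  have /choice[K HK] : forall ij : nat * nat, exists K, forall k, K <= k ->
      n * n * a ij.1 k <= b ij.2 k by move=> [i j]; apply: ab.
  exists (\max_(i < n.+1) \max_(j < n.+1) K (val i, val j)) => k' kk' i j.
  rewrite -ltnS => iN; rewrite -ltnS => jN; apply: (HK (i, j)).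
  apply: leq_trans kk'; apply: leq_trans (leq_bigmax (Ordinal iN)).
  exact: leq_trans (leq_bigmax (Ordinal jN)).
pose r k := \max_(n < k.+1 | `[< Q n k >]) n.
have Qr k : Q (r k) k.
  have [|n /asboolP Qn rE] := @eq_bigmax_cond _ [pred n : 'I_k.+1 | `[< Q n k >]] val.
    by apply/card_gt0P; exists ord0; apply/asboolP.
  by rewrite /r; move: rE => /= ->.
have r_ge n k : n <= k -> Q n k -> n <= r k.
  rewrite -ltnS => nk Qn.
  apply: (@leq_bigmax_cond _ _ (fun i : 'I_k.+1 => val i) (Ordinal nk)).
  exact/asboolP.
have r_homo : {homo r : m n / m <= n}.
  move=> m n mn; apply: r_ge; last exact: QS (Qr m).
  apply: leq_trans mn; by apply/bigmax_leqP => i _; rewrite -ltnS.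
have r_ev n : exists K, forall k, K <= k -> n <= r k.
  have [K QK] := QE n; exists (maxn n K) => k; rewrite geq_max => /andP[nk Kk].
  by apply: r_ge => //; apply: QS QK.
pose A k := \max_(i < (r k).+1) a i k.
have a_leA i k : i <= r k -> a i k <= A k.
  rewrite -ltnS => ir.
  exact: (@leq_bigmax _ (fun i : 'I_(r k).+1 => a i k) (Ordinal ir)).
exists (fun k => r k * A k).
  move=> m n mn; apply: leq_mul; first exact: r_homo.
  apply/bigmax_leqP => i _; apply: leq_trans (mon_a i _ _ mn) _.
  by apply: a_leA; apply: leq_trans (r_homo _ _ mn); rewrite -ltnS.
move=> i; split=> N.
- have [K HK] := r_ev (maxn N i); exists K => k /HK.
  by rewrite geq_max => /andP[Nr ir]; rewrite leq_mul // a_leA.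
- have [K HK] := r_ev (maxn N i); exists K => k /HK.
  rewrite geq_max => /andP[Nr ir].
  have [j _ ->] : exists2 j : 'I_(r k).+1, true & A k = a j k.
    have [|j _ E] := @eq_bigmax_cond _ [pred j : 'I_(r k).+1 | true] (fun j => a j k).
      by apply/card_gt0P; exists ord0.
    by exists j.
  rewrite mulnA; apply: leq_trans (Qr k k (leqnn _) j i _ ir).
    by rewrite leq_mul // leq_mul.
  by rewrite -ltnS.
Qed.

Lemma countable_enum T (A : set T) (a0 : T) : A a0 -> countable A ->
  exists e : nat -> T, (forall n, A (e n)) /\ forall a, A a -> exists n, e n = a.
Proof.
move=> Aa0 /countable_injP[f finj].
have /choice[e He] : forall n, exists a, A a /\ forall b, A b -> f b = n -> b = a.
  move=> n; have [[a [Aa fa]]|nex] := pselect (exists a, A a /\ f a = n).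
    exists a; split=> // b Ab fb; apply: finj; rewrite ?inE //.
    by rewrite fa.
  by exists a0; split=> // b Ab fb; case: nex; exists b.
exists e; split=> [n|a Aa]; first by case: (He n).
by exists (f a); case: (He (f a)) => _ /(_ a Aa erefl).
Qed.

Lemma slower_between (A B : set (nat -> nat)) (a0 b0 : nat -> nat) :
    A a0 -> B b0 -> countable A -> countable B ->
    (forall a, A a -> {homo a : m n / m <= n}) ->
    (forall a b, A a -> B b -> slower a b) ->
  exists2 c, {homo c : m n / m <= n} &
    (forall a, A a -> slower a c) /\ (forall b, B b -> slower c b).
Proof.
move=> Aa0 Bb0 /(countable_enum Aa0)[a [Aa surA]].
move=> /(countable_enum Bb0)[b [Bb surB]] homA AB.
have [||c hc Hc] := @slower_between_seq a b.
- by move=> i; apply: homA.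
- by move=> i j; apply: AB.
exists c => //; split=> [_ /surA[n <-]|_ /surB[n <-]]; by case: (Hc n).
Qed.

(** * Growth rates along aleph_1 *)

Lemma well_order_exists (W : Type) : exists S : W -> W -> Prop,
  [/\ well_founded S, (forall x y z, S x y -> S y z -> S x z) &
      forall x y, [\/ S x y, x = y | S y x]].
Proof.
elim/Peq: W => W.
have [R wo] := wochoice.well_ordering_principle W.
have tot x y : R x y || R y x.
  have [|z [[zin lb] _]] := wo (pred2 x y); first by exists x; rewrite !inE eqxx.
  move: zin lb; rewrite !inE => /orP[] /eqP-> lb.
    by apply/orP; left; apply: lb; rewrite !inE eqxx orbT.
  by apply/orP; right; apply: lb; rewrite !inE eqxx.
have anti x y : R x y -> R y x -> x = y.
  move=> xy yx; have [|z [_ uz]] := wo (pred2 x y).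
    by exists x; rewrite !inE eqxx.
  have refl t : R t t by have := tot t t; rewrite orbb.
  rewrite -(uz x) ?(uz y) //; split; rewrite ?inE ?eqxx ?orbT //.
    by move=> t; rewrite !inE => /orP[] /eqP->.
  by move=> t; rewrite !inE => /orP[] /eqP->.
pose S x y := R x y /\ x <> y.
have wfS : well_founded S.
  move=> x; apply: contrapT => nAx.
  have [|z [[]]] := wo [pred t | `[< ~ Acc S t >]].
    by exists x; apply/asboolP.
  move=> /asboolP nAz lb _; apply: nAz; constructor=> y [Ryz yz].
  apply: contrapT => nAy; apply: yz; apply: anti => //.
  by apply: lb; apply/asboolP.
have tri x y : [\/ S x y, x = y | S y x].
  have [->|/eqP xy] := eqVneq x y; first exact: Or32.
  by have /orP[Rxy|Ryx] := tot x y; [apply: Or31|apply: Or33; split=> // /esym].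
exists S; split=> // x y z Sxy Syz; have [//|xz|Szx] := tri x z.
  by case: Sxy Syz => Rxy nxy [Ryz _]; case: nxy; apply: anti => //; rewrite xz.
(* A cycle of three is excluded by well-foundedness: rotating it replaces [x] by the smaller [z]. *)
exfalso; elim/(well_founded_induction wfS): x y z Sxy Syz Szx => x IH y z *.
exact: (IH z _ x y).
Qed.

Lemma card_le_injection T U (A : set T) (B : set U) (u : U) : A #<= B ->
  exists2 f : T -> U, set_fun A B f & set_inj A f.
Proof.
elim/Ppointed: U => U in B u *; first by case: (no u).
by move=> /pcard_leP/injfunPex.
Qed.

Lemma injection_card_le T U (A : set T) (B : set U) (f : T -> U) :
  set_fun A B f -> set_inj A f -> A #<= B.
Proof.
move=> fAB finj.
by have [g] : $|{injfun A >-> B}| by [apply/injfunPex; exists f]; apply: inj_card_le g.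
Qed.

(** The order on [W] may be longer than omega_1, so the points with countable initial segment stand
    for omega_1. Were they countable in number, a least point outside them would have a countable
    initial segment too. *)
Lemma aleph1_well_order (W : Type) : card_aleph1 W ->
  exists S : W -> W -> Prop,
  [/\ well_founded S, (forall x y, [\/ S x y, x = y | S y x]),
      (forall x y z, S x y -> S y z -> S x z) &
      ~ countable [set a | countable [set b | S b a]]].
Proof.
move=> [ncW _]; have [S [wfS trS triS]] := well_order_exists W.
exists S; split=> //.
set I := [set a | _] => cI.
have [a nIa] : exists a, ~ I a.
  by apply/existsNP => allI; apply: ncW; rewrite (_ : setT = I) //; apply/seteqP; split.
elim/(well_founded_induction wfS): a nIa => a IH nIa.
apply: nIa; apply: sub_countable cI; apply: subset_card_le => b /= Sba.
by apply: contrapT => /(IH b Sba).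
Qed.

Lemma uncountable_aleph1 (W : Type) (I : set W) :
  card_aleph1 W -> ~ countable I -> I #= [set: W].
Proof. by move=> [_ /(_ I)[]]. Qed.

(** * A binary tree of growth rates *)

Section SlowerTree.
Variables (W : Type) (S : W -> W -> Prop).
Hypothesis wfS : well_founded S.
Hypothesis trS : forall x y z, S x y -> S y z -> S x z.
Hypothesis triS : forall x y, [\/ S x y, x = y | S y x].

(* [c] separates the values [h b] chosen below [a], according to whether [b]
   lies in [x]; the constant 1 and the identity bound the whole construction. *)
Let separates a (h : forall b, S b a -> set W -> nat -> nat) (x : set W)
    (c : nat -> nat) : Prop :=
  [/\ {homo c : m n / m <= n}, slower (fun=> 1) c /\ slower c id &
    forall b (Sba : S b a), (x b -> slower (h b Sba x) c) /\
                            (~ x b -> slower c (h b Sba x))].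

Let tree_step a (h : forall b, S b a -> set W -> nat -> nat) (x : set W) :=
  xget (id : nat -> nat) [set c | separates h x c].

(** The rate at height [a] of the branch [x], by transfinite recursion; [id] is a default where no
    separating rate exists. *)
Definition slower_tree : W -> set W -> nat -> nat :=
  Fix wfS (fun=> set W -> nat -> nat) tree_step.

Lemma slower_treeE a x : slower_tree a x =
  xget (id : nat -> nat) [set c | separates (fun b (_ : S b a) => slower_tree b) x c].
Proof.
rewrite /slower_tree Fix_eq // => {}a f g fg; congr tree_step.
by apply: functional_extensionality_dep => b; apply/funext => Sba.
Qed.

(** This makes the family a tree: two branches share their rates up to and including the first point
    where they differ. *)
Lemma slower_tree_local a x y :
  (forall b, S b a -> x b <-> y b) -> slower_tree a x = slower_tree a y.
Proof.
elim/(well_founded_induction wfS): a => a IH xy; rewrite !slower_treeE.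
have hE b : S b a -> slower_tree b x = slower_tree b y.
  by move=> Sba; apply: IH => // c Scb; apply: xy; apply: trS Sba.
congr xget; apply/seteqP; split=> c [hc c1 Hc]; split=> // b Sba.
- have [H1 H2] := Hc b Sba; rewrite -hE //.
  by split=> [/(xy b Sba)|nyb]; [|apply: H2 => /(xy b Sba)].
- have [H1 H2] := Hc b Sba; rewrite hE //.
  by split=> [/(xy b Sba)|nyb]; [|apply: H2 => /(xy b Sba)].
Qed.

(** Only countably many rates were chosen before [a]. Those to exceed and those to stay under form
    two countable families, between which a rate can be inserted. *)
Lemma slower_treeP a x : countable [set b | S b a] ->
  [/\ {homo slower_tree a x : m n / m <= n},
      slower (fun=> 1) (slower_tree a x) /\ slower (slower_tree a x) id &
      forall b, S b a ->
        (x b -> slower (slower_tree b x) (slower_tree a x)) /\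
        (~ x b -> slower (slower_tree a x) (slower_tree b x))].
Proof.
elim/(well_founded_induction wfS): a => a IH ca; rewrite slower_treeE.
have {}IH b (Sba : S b a) := IH b Sba
  (sub_countable (subset_card_le (fun c (Scb : S c b) => trS Scb Sba)) ca).
have cim (P : set W) : countable (slower_tree ^~ x @` ([set b | S b a] `&` P)).
  apply: sub_countable ca; apply: card_le_trans (card_image_le _ _) _.
  by apply: subset_card_le => b [].
pose A := [set fun=> 1] `|` slower_tree ^~ x @` ([set b | S b a] `&` x).
pose B := [set id] `|` slower_tree ^~ x @` ([set b | S b a] `&` ~` x).
have cP P (f : nat -> nat) :
    countable ([set f] `|` slower_tree ^~ x @` ([set b | S b a] `&` P)).
  rewrite -bigcup2E; apply: bigcup_countable => // -[|[|n]] _ //=; exact: cim.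
have slower1 : slower (fun=> 1) id by move=> N; exists N => k; rewrite muln1.
have [||||||c hc [Ac cB]] := @slower_between A B (fun=> 1) id.
- by left.
- by left.
- exact: cP.
- exact: cP.
- by move=> f [->//|[b [/= Sba _] <-]]; case: (IH b Sba).
- move=> f g [->|[b [/= Sba xb] <-]] [->//|[c [/= Sca nxc] <-]].
  + by case: (IH c Sca) => _ [].
  + by case: (IH b Sba) => _ [].
  (* Of a rate to exceed and one to stay under, the later was chosen on the right side of the
     earlier. *)
  + have [Sbc|bc|Scb] := triS b c; last 1 first.
    * by case: (IH b Sba) => _ _ /(_ c Scb)[_]; apply.
    * by case: (IH c Sca) => _ _ /(_ b Sbc)[+ _]; apply.
    * by case: nxc; rewrite -bc.
have : separates (fun b (_ : S b a) => slower_tree b) x c.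
  split=> //; first by split; [apply: Ac; left|apply: cB; left].
  by move=> b Sba; split=> xb; [apply: Ac|apply: cB]; right; exists b.
by move=> sc; case: (xgetPex (id : nat -> nat) (ex_intro _ c sc)).
Qed.

End SlowerTree.

(* Two subsets of [W] first differing at [a] are separated by the value of the
   tree at [a]: [G x] consists of the values lying above the branch [x]. *)
Lemma slower_cuts (W : Type) : card_aleph1 W ->
  exists G : set W -> set (nat -> nat),
  [/\ forall x, G x id,
      forall x g, G x g -> {homo g : m n / m <= n} /\ slower (fun=> 1) g /\
        exists K, forall k, K <= k -> g k <= k,
      forall x g h, G x g -> G x h -> [\/ g = h, slower g h | slower h g] &
      forall x y, x <> y ->
        (exists2 g, G x g & forall h, G y h -> slower g h) \/
        (exists2 g, G y g & forall h, G x h -> slower g h)].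
Proof.
move=> aW; have [S [wfS triS trS ncI]] := aleph1_well_order aW.
set I := [set a | _] in ncI.
pose T := slower_tree wfS.
have T_local := @slower_tree_local _ _ wfS trS.
have TP a x (Ia : I a) := slower_treeP wfS trS triS x Ia.
have := uncountable_aleph1 aW ncI; rewrite card_eq_le => /andP[_ WI].
have [w0] : inhabited W.
  apply: contrapT => W0; apply: ncI; rewrite (_ : I = set0) //.
  by apply/seteqP; split=> // w; case: W0.
(* The nodes are the points of [I], while branches are indexed by all subsets of [W]; [phi] carries
   the latter into [I]. *)
have {WI} [phi phiI phi_inj] := card_le_injection w0 WI.
pose H (z : set W) := [set id] `|` [set T a z | a in I `&` ~` z].
exists (fun x => H (phi @` x)); split.
- by move=> x; left.
- move=> x g [->|[a [Ia _] <-]].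
    split=> //; split; first by move=> N; exists N => k; rewrite muln1.
    by exists 0.
  have [hT [T1 Tid] _] := TP a (phi @` x) Ia; do 2!split=> //.
  by have [K HK] := Tid 1; exists K => k /HK; rewrite mul1n.
- move=> x g h [->|[a [Ia nxa] <-]] [->|[b [Ib nxb] <-]].
  + exact: Or31.
  + by apply: Or33; case: (TP b (phi @` x) Ib) => _ [].
  + by apply: Or32; case: (TP a (phi @` x) Ia) => _ [].
  + have [Sab|->|Sba] := triS a b; first 1 last; first exact: Or31.
    * by apply: Or32; case: (TP a (phi @` x) Ia) => _ _ /(_ b Sba)[_]; apply.
    * by apply: Or33; case: (TP b (phi @` x) Ib) => _ _ /(_ a Sab)[_]; apply.
(* It remains to treat the least point [a] where two branches part, with [a] outside [x] and inside
   [y]; the other case is symmetric. *)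
suff key (x y : set W) a : I a -> (forall b, S b a -> x b <-> y b) ->
    ~ x a -> y a -> exists2 g, H x g & forall h, H y h -> slower g h.
  move=> x y xy.
  have [a Ha] : exists a, I a /\ ~ ((phi @` x) a <-> (phi @` y) a).
    apply: contrapT => nex; apply: xy; apply/seteqP.
    have phiE z w : (phi @` z) (phi w) <-> z w.
      split=> [[v zv /phi_inj vw]|zw]; last by exists w.
      by rewrite -vw ?inE.
    have E w : x w <-> y w.
      rewrite -phiE -(phiE y); apply: contrapT => nE.
      by apply: nex; exists (phi w); split=> //; apply: phiI.
    by split=> w /E.
  elim/(well_founded_induction wfS): a Ha => a IH [Ia nxy].
  have [[b [Sba Hb]]|nb] := pselect (exists b,
      S b a /\ (I b /\ ~ ((phi @` x) b <-> (phi @` y) b))).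
    exact: (IH b).
  have Iseg b : S b a -> I b.
    move=> Sba; apply: sub_countable Ia; apply: subset_card_le => c /= Scb.
    exact: trS Sba.
  have agree b : S b a -> (phi @` x) b <-> (phi @` y) b.
    move=> Sba; apply: contrapT => nE; apply: nb; exists b; split=> //.
    by split=> //; apply: Iseg.
  have [xa|nxa] := pselect ((phi @` x) a); [right|left].
    apply: (key _ _ a) => //; first by move=> b /agree[].
    by move=> ya; apply: nxy.
  apply: (key _ _ a) => //; apply: contrapT => nya; apply: nxy; split=> //.
(* Both branches carry the same rate at [a]. It belongs to the cut of [x], which misses [a], and
   lies below the whole cut of [y], which contains [a]. *)
move=> Ia agree nxa ya; exists (T a x); first by right; exists a.
have -> : T a x = T a y by apply: T_local.
move=> h [->|[b [Ib nyb] <-]].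
  by case: (TP a y Ia) => _ [].
have [Sab|ab|Sba] := triS a b.
- by case: (TP b y Ib) => _ _ /(_ a Sab)[+ _]; apply.
- by case: nyb; rewrite -ab.
- by case: (TP a y Ia) => _ _ /(_ b Sba)[_]; apply.
Qed.

(** * Cardinal comparisons with aleph_1 *)

Lemma aleph1_card_le (W V : Type) :
  card_aleph1 W -> ~ countable [set: V] -> [set: W] #<= [set: V].
Proof.
move=> aW; elim/Pchoice: V => V ncV.
have [v0] : inhabited V.
  apply: contrapT => V0; apply: ncV; rewrite (_ : setT = set0) //.
  by apply/seteqP; split=> // v; case: V0.
have [S [wfS triS trS ncI]] := aleph1_well_order aW.
have := uncountable_aleph1 aW ncI; rewrite card_eq_le => /andP[_ WI].
apply: card_le_trans WI _.
(* An injection of [I] into [V] by transfinite recursion: below [a] only countably many values have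
   been used, so the uncountable [V] still has a fresh one. *)
pose fresh a (phi : forall b, S b a -> V) :=
  xget v0 [set v | forall b (Sba : S b a), phi b Sba <> v].
pose phi := Fix wfS (fun=> V) fresh.
have phiE a : phi a = fresh a (fun b _ => phi b).
  rewrite /phi Fix_eq // => {}a f g fg; congr fresh.
  by apply: functional_extensionality_dep => b; apply/funext => Sba.
have phi_fresh a : countable [set b | S b a] -> forall b, S b a -> phi b <> phi a.
  move=> ca b Sba; rewrite [phi a]phiE.
  suff [v Hv] : exists v, forall b, S b a -> phi b <> v.
    exact: (xgetPex v0 (ex_intro (fun v => forall b, S b a -> phi b <> v) v Hv)).
  apply: contrapT => nex; apply: ncV.
  rewrite (_ : setT = phi @` [set b | S b a]).
    exact: sub_countable (card_image_le _ _) ca.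
  apply/seteqP; split=> // v _; apply: contrapT => nv; apply: nex; exists v.
  by move=> c Sca cv; apply: nv; exists c.
apply: (@injection_card_le _ _ _ _ phi) => // a b; rewrite !inE => Ia Ib ab.
have [Sab|//|Sba] := triS a b; first by case: (phi_fresh b Ib a Sab).
by case: (phi_fresh a Ia b Sba).
Qed.

Lemma aleph1_card_eq (W V : Type) :
  card_aleph1 W -> card_aleph1 V -> [set: W] #= [set: V].
Proof.
by move=> aW aV; rewrite card_eq_le !aleph1_card_le //; [case: aW|case: aV].
Qed.

Lemma card_le_set (T U : Type) : [set: T] #<= [set: U] ->
  [set: set T] #<= [set: set U].
Proof.
move=> TU; have [[u0]|U0] := pselect (inhabited U); last first.
  apply: (@injection_card_le _ _ _ _ (fun=> set0)) => // A B _ _ _.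
  move: TU; rewrite (_ : [set: U] = set0) => [/card_le0P T0|].
    by apply/seteqP; split=> t; have : [set: T] t by []; rewrite T0.
  by apply/seteqP; split=> // u; case: U0.
have [f _ finj] := card_le_injection u0 TU.
apply: (@injection_card_le _ _ _ _ (fun A => f @` A)) => // A B _ _ AB.
have im (C : set T) t : (f @` C) (f t) <-> C t.
  split=> [[s Cs /finj st]|]; last by exists t.
  by rewrite -st ?inE.
by apply/seteqP; split=> t /im; [rewrite AB|rewrite -AB] => /im.
Qed.

Local Open Scope ring_scope.

(** * Valuations and prime ideals of power series rings *)

Lemma sum_witness (V : nmodType) (P : V -> Prop) n (F : 'I_n -> V) :
    ~ P 0 -> (forall x y, P (x + y) -> P x \/ P y) ->
  P (\sum_(i < n) F i) -> exists i, P (F i).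
Proof.
by move=> P0 PD; elim/big_rec: _ => [//|i x _ IH /PD[Pi|/IH//]]; exists i.
Qed.

(* A valuation with values in the nonnegative rationals together with +oo:
   [v x] is the value of [x] if [Q x] holds, and the value is +oo otherwise. *)
Record valuation (A : comNzRingType) (Q : A -> Prop) (v : A -> rat) : Prop :=
  Valuation {
    valuation_ge0 : forall x, Q x -> 0 <= v x;
    valuation_fin0 : ~ Q 0;
    valuation_fin1 : Q 1;
    valuation_finM : forall x y, Q (x * y) <-> Q x /\ Q y;
    valuationM : forall x y, Q x -> Q y -> v (x * y) = v x + v y;
    valuationD : forall x y, Q (x + y) ->
      (Q x /\ v x <= v (x + y)) \/ (Q y /\ v y <= v (x + y))
  }.

(** * Monomial extension of a valuation to power series *)

Section GaussValuation.
Variables (A : comNzRingType) (Q : A -> Prop) (v : A -> rat).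
Hypothesis vP : valuation Q v.
Implicit Types (f g : power_series A) (s t : rat).

Lemma valuation1 : v 1 = 0.
Proof.
have Q1 := valuation_fin1 vP; have := valuationM vP Q1 Q1.
by rewrite mulr1 => /eqP; rewrite -subr_eq0 opprD addNKr oppr_eq0 => /eqP.
Qed.

(* The value of [f] is at least [t] for the monomial extension of the
   valuation in which the variable has value 1. *)
Definition gauss_ge f t : Prop :=
  forall n, Q (series_coef f n) -> t - n%:R <= v (series_coef f n).

Lemma gauss_ge_le f s t : s <= t -> gauss_ge f t -> gauss_ge f s.
Proof. by move=> st ft n /ft; apply: le_trans; rewrite lerD2r. Qed.

Lemma gauss_ge0 t : gauss_ge 0 t.
Proof. by move=> n /(valuation_fin0 vP). Qed.

Lemma gauss_geD f g t : gauss_ge f t -> gauss_ge g t -> gauss_ge (f + g) t.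
Proof.
move=> ft gt n /= /(valuationD vP)[] [Qx]; apply: le_trans; [exact: ft|exact: gt].
Qed.

Lemma gauss_geM f g t : gauss_ge g t -> gauss_ge (f * g) t.
Proof.
move=> gt n; set x := series_coef _ _ => Qx; rewrite leNgt; apply/negP => vx.
have [||i [Qi vi]] := @sum_witness A (fun x => Q x /\ v x < t - n%:R) n.+1
    (fun i => series_coef f i * series_coef g (n - i)) _ _ (conj Qx vx).
- by case=> /(valuation_fin0 vP).
- move=> y z [/[dup] Qyz /(valuationD vP)[] [Qy vy] lt_t]; [left|right];
    by split=> //; apply: le_lt_trans lt_t.
have [Qf Qg] := (valuation_finM vP _ _).1 Qi.
have := gt _ Qg; move: vi; rewrite (valuationM vP Qf Qg) natrB; last by rewrite -ltnS.
have := valuation_ge0 vP Qf; have : 0 <= i%:R :> rat by rewrite ler0n.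
lra.
Qed.

(** The least weight is attained because [w m] is at least m, so that only finitely many indices
    stay below [t]. The first minimal index is taken, as a Gauss lemma requires. *)
Lemma gauss_attained f t : ~ gauss_ge f t ->
  exists n, let w m := v (series_coef f m) + m%:R in
  [/\ Q (series_coef f n), w n < t,
      forall m, Q (series_coef f m) -> w n <= w m &
      forall m, (m < n)%N -> Q (series_coef f m) -> w n < w m].
Proof.
move=> nft; pose w m := v (series_coef f m) + m%:R.
have [n0 [Qn0 wn0]] : exists n, Q (series_coef f n) /\ w n < t.
  apply: contrapT => nex; apply: nft => n Qn; rewrite lerBlDr leNgt.
  by apply/negP => wn; apply: nex; exists n.
have w_ge m : Q (series_coef f m) -> m%:R <= w m.
  by move=> Qm; rewrite lerDr (valuation_ge0 vP Qm).
have [N tN] : exists N : nat, t < N%:R.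
  exists (Num.bound `|t|); apply: le_lt_trans (ler_norm t) _.
  exact/archi_boundP/normr_ge0.
have lt_N m : Q (series_coef f m) -> w m < t -> (m < N)%N.
  by move=> /w_ge wm wt; rewrite -(ltr_nat rat); lra.
have n0N := lt_N _ Qn0 wn0.
case: (@Order.TotalTheory.arg_minP _ _ _ (Ordinal n0N)
  (fun i : 'I_N => `[< Q (series_coef f i) >]) (fun i => w i)); first exact/asboolP.
move=> n1 /asboolP Qn1 minn1.
have {}minn1 m : Q (series_coef f m) -> w n1 <= w m.
  move=> Qm; have [wm|] := ltP (w m) t.
    by apply: (minn1 (Ordinal (lt_N m Qm wm))); apply/asboolP.
  apply: le_trans; apply: le_trans (ltW wn0).
  by apply: (minn1 (Ordinal n0N)); apply/asboolP.
have ex : exists n, `[< Q (series_coef f n) >] && (w n == w n1).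
  by exists n1; rewrite eqxx andbT; apply/asboolP.
have wn1 : w n1 < t by apply: le_lt_trans wn0; apply: minn1.
case: (ex_minnP ex) => n /andP[/asboolP Qn /eqP wn] least; exists n.
split=> // [|m Qm|m mn Qm].
- by rewrite -/(w n) wn.
- by rewrite -/(w n) -/(w m) wn; apply: minn1.
rewrite -/(w n) -/(w m) lt_neqAle wn minn1 // andbT.
apply: contraTN mn => /eqP/esym wm; rewrite -leqNgt; apply: least.
by rewrite wm eqxx andbT; apply/asboolP.
Qed.

(** Gauss's lemma: if [n] and [m] are the first indices of minimal weight in [f] and [g], the
    coefficient of index [n + m] in the product has a single term of least value. *)
Lemma gauss_not_geM f g s t :
  ~ gauss_ge f s -> ~ gauss_ge g t -> ~ gauss_ge (f * g) (s + t).
Proof.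
move=> /gauss_attained[n [Qn wn minn ltn]] /gauss_attained[m [Qm wm minm ltm]].
move=> /(_ (n + m)%N) /=.
have nlt : (n < (n + m).+1)%N by rewrite ltnS leq_addr.
rewrite (bigD1 (Ordinal nlt)) //= addKn.
set a := _ * _; set b := \sum_(i < _ | _) _ => vab.
have Qa : Q a by apply/(valuation_finM vP).
have va : v a = v (series_coef f n) + v (series_coef g m).
  exact: valuationM vP _ _ _ _.
have vb : Q b -> v a < v b.
  pose P x := Q x /\ v x <= v a.
  move=> Qb; rewrite ltNge; apply/negP => ba; have : P b by split.
  elim/big_ind: (b) => [[/(valuation_fin0 vP)]//|x y Px Py [Qxy xya]|i ni [Qi]].
    have [] := valuationD vP Qxy => -[Qz zxy]; [apply: Px|apply: Py];
      by split=> //; apply: le_trans xya.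
  apply/negP; rewrite -ltNge va.
  have [Qf Qg] := (valuation_finM vP _ _).1 Qi.
  rewrite (valuationM vP Qf Qg).
  have in_le : (i <= n + m)%N by rewrite -ltnS.
  have := minn _ Qf; have := minm _ Qg; rewrite natrB // natrD.
  have [lt_in|lt_ni|eq_in] := ltngtP i n.
  - by have := ltn _ lt_in Qf; lra.
  - have : (n + m - i < m)%N by lia.
    by move=> /ltm/(_ Qg); rewrite natrB // natrD; lra.
  - by case/eqP: ni; apply: val_inj.
have [Qab v_ab] : Q (a + b) /\ v (a + b) <= v a.
  (* Read [a] as [(a + b) - b]: since [b] has larger value than [a], the bound by [v a] must come
     from [a + b]. *)
  have := @valuationD _ _ _ vP (a + b) (-1 * b).
  rewrite mulN1r addrK => /(_ Qa)[] // [].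
  rewrite -mulN1r => QNb; have [QN1 Qb] := (valuation_finM vP _ _).1 QNb.
  rewrite (valuationM vP QN1 Qb).
  by have := valuation_ge0 vP QN1; have := vb Qb; lra.
have /vab := Qab; apply/negP; rewrite -ltNge.
by rewrite natrD; move: v_ab wn wm; rewrite va; lra.
Qed.

Lemma gauss_ge1 t : gauss_ge 1 t -> t <= 0.
Proof.
move=> /(_ 0%N); rewrite (_ : series_coef 1 0 = 1) // valuation1 subr0.
by apply; apply: valuation_fin1 vP.
Qed.

End GaussValuation.

(** * Prime ideals defined by growth along an ultrafilter *)

Section GrowthIdeals.
Variables (A : comNzRingType) (Q : nat -> A -> Prop) (v : nat -> A -> rat).
Hypothesis vP : forall k, valuation (Q k) (v k).
Variable U : set_system nat.
Hypothesis ultraU : UltraFilter U.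
Hypothesis cofinite_U : \oo `<=` U.
Implicit Types (f : power_series A) (g h : nat -> nat).

(** The unspecified [N] makes these ideals prime: when a product reaches a threshold, one factor
    reaches half of it. *)
Definition growth_ideal h : pred (power_series A) := fun f =>
  `[< exists N, U [set k | gauss_ge (Q k) (v k) f ((h k)%:R / N.+1%:R)] >].

Let UF : Filter U. Proof. exact: (@filter_filter _ _ (@ultra_proper _ _ ultraU)). Qed.

Let filter_exI P P' : U P -> U P' -> exists k, P k /\ P' k.
Proof.
move=> UP UP'.
by have [k []] := @filter_ex _ U (@ultra_proper _ _ ultraU) _ (filterI UP UP'); exists k.
Qed.

Let ev_pos h : slower (fun=> 1%N) h -> forall N, U [set k | (N < h k)%N].
Proof.
move=> h1 N; have [K HK] := h1 N.+1; apply: cofinite_U; exists K => // k /HK.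
by rewrite muln1.
Qed.

Lemma growth_ideal_prime h : U [set k | (0 < h k)%N] -> prime_ideal (growth_ideal h).
Proof.
move=> h0.
have mono k m n (mn : (m <= n)%N) f :
    gauss_ge (Q k) (v k) f ((h k)%:R / m.+1%:R) ->
    gauss_ge (Q k) (v k) f ((h k)%:R / n.+1%:R).
  apply: gauss_ge_le; rewrite ler_wpM2l ?ler0n // lef_pV2 ?posrE ?ltr0n //.
  by rewrite ler_nat.
split; first split.
- by apply/asboolP; exists 0%N; apply: filterS filterT => k _; apply: gauss_ge0.
- apply/negP => /asboolP[N UN].
  have [k [/= hk /(gauss_ge1 (vP k))]] := filter_exI h0 UN.
  by apply/negP; rewrite -ltNge divr_gt0 ?ltr0n.
- move=> a f g /asboolP[M UM] /asboolP[N UN]; apply/asboolP; exists (maxn M N).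
  apply: filterS (filterI UM UN) => k [/= fM gN]; apply: gauss_geD => //.
    by apply: gauss_geM => //; apply: mono fM; apply: leq_maxl.
  by apply: mono gN; apply: leq_maxr.
move=> f g /asboolP[N UN].
(* The ultrafilter decides whether [f] reaches half the threshold, [(2 * N).+2] being twice [N.+1];
   where [f] does not, [g] must. *)
have [Uf|Uf] := in_ultra_setVsetC
  [set k | gauss_ge (Q k) (v k) f ((h k)%:R / (2 * N).+2%:R)] ultraU.
  by apply/orP; left; apply/asboolP; exists (2 * N).+1.
apply/orP; right; apply/asboolP; exists (2 * N).+1.
apply: filterS (filterI Uf UN) => k [/= nf fg]; apply: contrapT => ng.
apply: (gauss_not_geM (vP k) nf ng); apply: gauss_ge_le fg.
rewrite (_ : (2 * N).+2 = (N.+1 * 2)%N); last by lia.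
by rewrite natrM invfM mulrA -splitr.
Qed.

Lemma growth_idealS g h : slower g h ->
  {subset growth_ideal h <= growth_ideal g}.
Proof.
move=> gh f /asboolP[N UN]; apply/asboolP; exists 0%N.
have [K HK] := gh N.+1.
have UK : U [set k | (K <= k)%N] by apply: cofinite_U; exists K.
apply: filterS (filterI UN UK) => k [/= fN /HK]; rewrite -(ler_nat rat) => gk.
apply: gauss_ge_le fN; rewrite divr1 ler_pdivlMr ?ltr0n //.
by rewrite mulrC -natrM.
Qed.

Definition series_var : power_series A := PowerSeries (fun n => (n == 1)%N%:R).

(** The variable has value 1 at every [k]. It thus separates the ideal of the constant rate, the
    future top of the chain, from those of rates tending to infinity. *)
Lemma series_var_growth : series_var \in growth_ideal (fun=> 1%N).
Proof.
apply/asboolP; exists 0%N; apply: filterS filterT => k _ [|n] /= Qn.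
  by case: (valuation_fin0 (vP k)).
apply: le_trans (valuation_ge0 (vP k) Qn).
by rewrite divr1 subr_le0 ler1n.
Qed.

Lemma series_varN_growth h : slower (fun=> 1%N) h ->
  series_var \notin growth_ideal h.
Proof.
move=> h1; apply/negP => /asboolP[N UN].
have [k [/= hk /(_ 1%N)]] := filter_exI (ev_pos h1 N.+1) UN.
rewrite /= mulr1n (valuation1 (vP k)) => /(_ (valuation_fin1 (vP k))).
apply/negP; rewrite -ltNge subr_gt0 ltr_pdivlMr ?ltr0n // mul1r ltr_nat.
exact: hk.
Qed.

Variable b : nat -> A.
Hypothesis b_large : forall j k, (j <= k)%N -> Q k (b j) -> k%:R <= v k (b j).
Hypothesis b_small : forall j k, (k < j)%N -> Q k (b j) /\ v k (b j) <= 1.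

(* The value of [sum_n b (m n) Y^n] at the [k]-th valuation is governed by the
   first [n] with [k < m n], that is by [n = g k]. *)
Lemma growth_witness g : {homo g : m n / (m <= n)%N} ->
    slower (fun=> 1%N) g -> (exists K, forall k, (K <= k)%N -> (g k <= k)%N) ->
  exists2 f, f \in growth_ideal g &
    forall h, slower g h -> f \notin growth_ideal h.
Proof.
move=> hg g1 [K0 gk_le].
have gex n : exists k, (n < g k)%N.
  by have [k []] := filter_exI (ev_pos g1 n) (ev_pos g1 n); exists k.
(* A generalised inverse of [g]: at the k-th valuation, [b (m n)] is large for [n < g k] and small
   from [n = g k] on. *)
pose m n := ex_minn (gex n).
have m_le n k : (m n <= k)%N = (n < g k)%N.
  rewrite /m; case: ex_minnP => l nl least; apply/idP/idP => [/hg|/least//].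
  exact: leq_trans.
exists (PowerSeries (fun n => b (m n))).
  apply/asboolP; exists 0%N.
  have UK : U [set k | (K0 <= k)%N] by apply: cofinite_U; exists K0.
  apply: filterS UK => k /= /gk_le gk n Qn; rewrite divr1 /=.
  have [mk|km] := leqP (m n) k.
    have := b_large mk Qn; have : (g k)%:R <= k%:R :> rat by rewrite ler_nat.
    by have : 0 <= n%:R :> rat by []; move: Qn => /=; lra.
  have := valuation_ge0 (vP k) Qn; apply: le_trans.
  by rewrite subr_le0 ler_nat leqNgt -m_le -ltnNge.
move=> h gh; apply/negP => /asboolP[N UN].
(* The factor 3 leaves room: the term of index [g k] bounds the value of the series by [g k + 1],
   which is less than [3 * g k] once [g k] is positive. *)
have [K HK] := gh (N.+1 * 3)%N.
have UK : U [set k | (K <= k)%N] by apply: cofinite_U; exists K.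
have [k [[/= hk Kk] g_pos]] := filter_exI (filterI UN UK) (ev_pos g1 0).
have km : (k < m (g k))%N by rewrite ltnNge m_le ltnn.
have [Qb vb] := b_small km; have := le_trans (hk (g k) Qb) vb.
rewrite lerBlDr ler_pdivrMr ?ltr0n //; apply/negP; rewrite -ltNge.
rewrite nat1r -natrM ltr_nat.
have /= := HK k Kk; rewrite /= in g_pos; nia.
Qed.

End GrowthIdeals.

(** The ideals of the rates in a cut [G x] form a chain, so their union [P x] is prime. Of two cuts,
    one has a rate below all of the other, which makes the [P x] comparable and distinct. *)
Theorem power_series_krull_dim_ge (A : comNzRingType) (Q : nat -> A -> Prop)
    (v : nat -> A -> rat) (b : nat -> A) (W : Type) :
    (forall k, valuation (Q k) (v k)) ->
    (forall j k, (j <= k)%N -> Q k (b j) -> k%:R <= v k (b j)) ->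
    (forall j k, (k < j)%N -> Q k (b j) /\ v k (b j) <= 1) ->
  card_aleph1 W -> krull_dim_ge (power_series A) [set: set W].
Proof.
move=> vP b_large b_small aW.
have [G [Gid Ggood Gtot Gsep]] := slower_cuts aW.
have [U [ultraU cofU]] := @ultraFilterLemma nat \oo _.
pose I := growth_ideal Q v U.
have UF : Filter U by exact: (@filter_filter _ _ (@ultra_proper _ _ ultraU)).
have I_prime h : slower (fun=> 1%N) h -> prime_ideal (I h).
  move=> h1; apply: growth_ideal_prime => //.
  have [K HK] := h1 1%N; by apply: cofU; exists K => // k /HK; rewrite muln1.
have IS := @growth_idealS A Q v U ultraU cofU.
pose P (x : set W) : pred (power_series A) := fun f =>
  `[< exists2 g, G x g & f \in I g >].
have PE x f : f \in P x <-> exists2 g, G x g & f \in I g.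
  by split=> [/asboolP|?]; last exact/asboolP.
have G1 x g : G x g -> slower (fun=> 1%N) g by move=> /Ggood[_ []].
have P_prime x : prime_ideal (P x).
  have join g h : G x g -> G x h ->
      exists2 i, G x i & {subset I g <= I i} /\ {subset I h <= I i}.
    move=> Gg Gh; case: (Gtot x g h Gg Gh) => [->|gh|hg].
    - by exists h => //; split=> f.
    - by exists g => //; split=> // f; apply: IS.
    - by exists h => //; split=> // f; apply: IS.
  split; first split.
  - by apply/PE; exists id => //; case: (I_prime id (G1 x id (Gid x))) => -[].
  - apply/negP => /PE[g Gg]; apply/negP.
    by case: (I_prime g (G1 x g Gg)) => -[].
  - move=> a f f' /PE[g Gg fg] /PE[h Gh f'h]; apply/PE.
    have [i Gi [gi hi]] := join g h Gg Gh; exists i => //.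
    case: (I_prime i (G1 x i Gi)) => -[_ _ /(_ a f f') + _]; apply; first exact: gi.
    exact: hi.
  - move=> f f' /PE[g Gg fg]; case: (I_prime g (G1 x g Gg)) => _ /(_ f f' fg).
    by case/orP => ?; apply/orP; [left|right]; apply/PE; exists g.
have P_below x y g : G x g -> (forall h, G y h -> slower g h) ->
    {subset P y <= P x} /\ exists2 f, f \in P x & f \notin P y.
  move=> Gg gy; split=> [f /PE[h Gh fh]|].
    by apply/PE; exists g => //; apply: IS fh; apply: gy.
  have [hg [g1 gid]] := Ggood x g Gg.
  have [f fg nf] := growth_witness vP ultraU cofU b_large b_small hg g1 gid.
  exists f; first by apply/PE; exists g.
  by apply/negP => /PE[h Gh]; apply/negP/nf/gy.
have P_sep x y : x <> y ->
    ({subset P y <= P x} /\ exists2 f, f \in P x & f \notin P y) \/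
    ({subset P x <= P y} /\ exists2 f, f \in P y & f \notin P x).
  by move=> /Gsep[] [g Gg Hg]; [left|right]; apply: (P_below _ _ g).
have P_inj : injective P.
  move=> x y Pxy; apply: contrapT => /P_sep[] [_ [f]]; rewrite Pxy;
  by move=> ->.
(* [M] lies strictly above every [P x]. It is the member removed in the length, which leaves the
   whole family indexed by [set W]. *)
pose M := I (fun=> 1%N).
have PM x : {subset P x <= M} by move=> f /PE[g Gg]; apply: IS; apply: G1 Gg.
have M_prime : prime_ideal M.
  by apply: growth_ideal_prime => //; apply: filterS filterT.
have P_neqM x : P x <> M.
  move=> PxM; have : series_var A \in M by apply: series_var_growth.
  rewrite -PxM => /PE[g Gg]; apply/negP; apply: series_varN_growth => //.
  exact: G1 Gg.
exists ([set M] `|` range P).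
  split; first by exists M; left.
  - by move=> _ [->//|[x _ <-]].
  - move=> _ _ [->|[x _ <-]] [->|[y _ <-]]; [by left|by right|by left|].
    have [->|/P_sep[] [xy _]] := pselect (x = y); [by left|by right|by left].
exists (pred (power_series A)), (([set M] `|` range P) `\ M); split.
  by exists M; [left|].
apply: (@injection_card_le _ _ _ _ P) => [x _|x y _ _ /P_inj//].
by split=> [|/P_neqM//]; right; exists x.
Qed.

(** * Ideals *)

Section Ideals.
Variable A : comNzRingType.
Implicit Types (I P M : pred A) (a x : A).

Lemma generated_by1 a x : generated_by [:: a] x <-> exists c, x = c * a.
Proof.
split=> [[c ->]|[c ->]].
  by exists (c ord0); rewrite big_ord1.
by exists (fun=> c); rewrite big_ord1.
Qed.

Lemma generated_by_cons a s x :
  generated_by (a :: s) x <-> exists c y, generated_by s y /\ x = c * a + y.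
Proof.
split=> [[c ->]|[c [_ [[d ->] ->]]]].
  exists (c ord0), (\sum_(i < size s) c (lift ord0 i) * s`_i); split.
    by exists (fun i => c (lift ord0 i)).
  by rewrite big_ord_recl.
exists (fun i : 'I_(size s).+1 => if unlift ord0 i is Some j then d j else c).
rewrite big_ord_recl unlift_none; congr (_ + _).
by apply: eq_bigr => i _; rewrite liftK.
Qed.

Lemma idealr_closed_mulr I a x : idealr_closed I -> x \in I -> a * x \in I.
Proof. by move=> [I0 _ Ilin] xI; rewrite -[a * x]addr0 Ilin. Qed.

Lemma maximal_ideal_prime M : maximal_ideal M -> prime_ideal M.
Proof.
move=> [idM maxM]; split=> // u v uvM; apply/orP.
have [|uM] := boolP (u \in M); [by left|right].
pose J : pred A := fun x => `[< exists2 m, m \in M & exists r, x = m + r * u >].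
have JE x : x \in J <-> exists2 m, m \in M & exists r, x = m + r * u.
  by split=> [/asboolP|?]; last exact/asboolP.
have [M0 _ Mlin] := idM.
have MJ : {subset M <= J}.
  by move=> m mM; apply/JE; exists m => //; exists 0; rewrite mul0r addr0.
have uJ : u \in J by apply/JE; exists 0 => //; exists 1; rewrite mul1r add0r.
have [/JE[m mM [r r1]]|nJ1] := boolP (1 \in J).
  rewrite -[v]mul1r r1 mulrDl -mulrA addrC Mlin //.
  by rewrite mulrC; apply: idealr_closed_mulr.
suff idJ : idealr_closed J by rewrite (maxM J idJ MJ u uJ) in uM.
split=> // [|a x y /JE[m mM [r ->]] /JE[n nM [s ->]]]; first exact: MJ.
apply/JE; exists (a * m + n); first exact: Mlin.
by exists (a * r + s); rewrite mulrDr mulrDl mulrA addrACA.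
Qed.

Lemma maximal_ideal_exists a :
  (forall x, x * a <> 1) -> exists2 M, maximal_ideal M & a \in M.
Proof.
move=> nUa.
pose good (S : set A) := idealr_closed (fun x => `[< S x >]) /\ S a.
have goodS S : good S <->
    [/\ S 0, ~ S 1, (forall c u v, S u -> S v -> S (c * u + v)) & S a].
  split=> [[[S0 S1 Slin] Sa]|[S0 S1 Slin Sa]].
    split=> // [|/asboolP S1'|c u v Su Sv]; first exact/asboolP.
      by rewrite unfold_in S1' in S1.
    by apply/asboolP; apply: Slin; apply/asboolP.
  split=> //; split; first exact/asboolP.
    by apply/negP => /asboolP.
  by move=> c u v /asboolP Su /asboolP Sv; apply/asboolP/Slin.
have [F FS Ftot|S [PS maxS]] := @Zorn_bigcup A (fun S => S = set0 \/ good S).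
  have [[S0 FS0 [x0 S0x]]|all0] := pselect (exists2 S, F S & S !=set0); last first.
    left; apply/seteqP; split=> // x [S FSS Sx]; apply: all0; exists S => //.
    by exists x.
  have Fgood S x : F S -> S x -> good S.
    by move=> /FS[->|].
  right; apply/goodS; have [S00 _ _ S0a] := (goodS _).1 (Fgood _ _ FS0 S0x).
  split; [by exists S0| |move=> c u v [S FSS Su] [T FT Tv]|by exists S0].
    by move=> [S FSS S1]; have /goodS[_] := Fgood _ _ FSS S1.
  have [ST|TS] := Ftot _ _ FSS FT.
    exists T => //; have /goodS[_ _ Tlin _] := Fgood _ _ FT Tv.
    by apply: Tlin => //; apply: ST.
  exists S => //; have /goodS[_ _ Slin _] := Fgood _ _ FSS Su.
  by apply: Slin => //; apply: TS.
have good_a : good [set x | exists c, x = c * a].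
  apply/goodS; split=> [|[c /esym /nUa]//|c u v [r ->] [s ->]|].
  - by exists 0; rewrite mul0r.
  - by exists (c * r + s); rewrite mulrDl mulrA.
  - by exists 1; rewrite mul1r.
case: PS => [S0|gS].
  case: (maxS [set x | exists c, x = c * a]); last by right.
  by rewrite S0; split=> // sub0; apply: (sub0 a); exists 1; rewrite mul1r.
have [idS Sa] := gS.
exists (fun x => `[< S x >]); last exact/asboolP.
split=> // I idI SI x xI; apply/asboolP; apply: contrapT => nSx.
apply: (maxS [set` I]).
  split; first by move=> y Sy; apply: SI; apply/asboolP.
  by move=> /(_ x xI).
right; apply/goodS; have [I0 /negP I1 Ilin] := idI; split=> //.
by apply: (SI a); apply/asboolP.
Qed.

End Ideals.

(** * The ring D *)

Section RootRingTheory.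
Variables (p : nat) (F L : fieldType) (iota : {rmorphism F -> L}).
Variables (X : nat -> L) (hX : compatible_roots p iota X).
Hypothesis p_prime : prime p.
Local Notation D := (root_ring hX).
Implicit Types (f g q : {poly F}) (z : D).

Let p_gt0 : (0 < p)%N := prime_gt0 p_prime.

Lemma roots_expn n k : X (n + k)%N ^+ (p ^ k) = X n.
Proof.
elim: k n => [|k IH] n; first by rewrite addn0 expr1.
by rewrite addnS expnS exprM (roots_compatible hX) IH.
Qed.

(** An algebraic [X n] would make its power [X 0] algebraic. *)
Lemma roots_algebraic_indep n f : (map_poly iota f).[X n] = 0 -> f = 0.
Proof.
move=> fX; apply/eqP; apply/negP => /negP f0; apply: (roots_transcendental hX).
have algX : algebraicOver iota (X n) by exists f => //; apply/eqP.
rewrite -(roots_expn 0 n) add0n.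
elim: (p ^ n)%N => [|k IH]; first by rewrite expr0; apply: algebraic1.
by rewrite exprS; apply: algebraic_mul.
Qed.

Lemma root_neq0 n : X n != 0.
Proof.
apply/eqP => Xn0; have := @roots_algebraic_indep n 'X.
by rewrite map_polyX hornerX => /(_ Xn0)/eqP; rewrite polyX_eq0.
Qed.

Fact root_eval_subproof n f : (map_poly iota f).[X n] \in root_subring hX.
Proof. by apply/mem_set; exists n => //; exists f, 0%N; rewrite expr0 divr1. Qed.

Definition root_eval n f : D := RootRing (root_eval_subproof n f).
Local Notation ev := root_eval.
Local Notation x n := (ev n 'X).

Lemma root_evalD n f g : ev n (f + g) = ev n f + ev n g.
Proof. by apply: val_inj; rewrite /= rmorphD hornerD. Qed.

Lemma root_evalM n f g : ev n (f * g) = ev n f * ev n g.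
Proof. by apply: val_inj; rewrite /= rmorphM hornerM. Qed.

Lemma root_eval1 n : ev n 1 = 1.
Proof. by apply: val_inj; rewrite /= rmorph1 hornerC. Qed.

Lemma root_eval0 n : ev n 0 = 0.
Proof. by apply: val_inj; rewrite /= rmorph0 hornerC. Qed.

Lemma root_evalB n f g : ev n (f - g) = ev n f - ev n g.
Proof. by apply: val_inj; rewrite /= rmorphB hornerD hornerN. Qed.

Lemma root_evalX n f k : ev n (f ^+ k) = ev n f ^+ k.
Proof. by elim: k => [|k IH]; rewrite ?root_eval1 // !exprS root_evalM IH. Qed.

Lemma root_eval_inj n : injective (ev n).
Proof.
move=> f g /(congr1 val) /= fg; apply/eqP; rewrite -subr_eq0; apply/eqP.
by apply: (@roots_algebraic_indep n); rewrite rmorphB hornerD hornerN fg subrr.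
Qed.

Lemma root_eval_lift m n f : (m <= n)%N -> ev m f = ev n (f \Po 'X^(p ^ (n - m))).
Proof.
move=> mn; apply: val_inj => /=.
rewrite map_comp_poly map_polyXn horner_comp hornerXn.
by rewrite -(roots_expn m (n - m)) subnKC.
Qed.

Lemma root_eval_unitX n : x n \is a GRing.unit.
Proof.
have Vx : (X n)^-1 \in root_subring hX.
  by apply/mem_set; exists n => //; exists 1, 1%N; rewrite rmorph1 hornerC expr1 div1r.
apply/unitrPr; exists (RootRing Vx); apply: val_inj => /=.
by rewrite map_polyX hornerX mulfV ?root_neq0.
Qed.

Lemma root_eval_surj z : exists n f k, z * x n ^+ k = ev n f.
Proof.
have /set_mem[n _ [f [k zE]]] := valP z; exists n, f, k.
apply: val_inj; rewrite rmorphM rmorphXn /= map_polyX hornerX zE.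
by rewrite mulfVK // expf_neq0 ?root_neq0.
Qed.

(** Every large level works, so that two elements can be brought to a common one. *)
Lemma root_eval_ex z : exists n0, forall n, (n0 <= n)%N ->
  exists f k, z * x n ^+ k = ev n f.
Proof.
have [m [f [k zE]]] := root_eval_surj z; exists m => n mn.
exists (f \Po 'X^(p ^ (n - m))), (p ^ (n - m) * k)%N.
by rewrite -root_eval_lift // -zE (root_eval_lift 'X mn) comp_polyX root_evalX exprM.
Qed.

Lemma root_eval_unitC n c : c != 0 -> ev n c%:P \is a GRing.unit.
Proof.
move=> c0; apply/unitrPr; exists (ev n c^-1%:P).
by rewrite -root_evalM -polyCM mulfV // root_eval1.
Qed.

Lemma root_eval_associate z : z != 0 -> exists n f (u : D),
  [/\ u \is a GRing.unit, f`_0 != 0 & z = u * ev n f].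
Proof.
move=> z0; have [n [f [k zE]]] := root_eval_surj z.
have f0 : f != 0.
  apply: contraNneq z0 => f0; move: zE; rewrite f0 root_eval0 => /eqP.
  by rewrite mulf_eq0 expf_eq0 => /orP[//|/andP[_ /eqP xn0]];
    have := root_eval_unitX n; rewrite xn0 unitr0.
have [i [g g0 fE]] := multiplicity_XsubC f 0; rewrite f0 /= in g0.
exists n, g, (x n ^+ i / x n ^+ k); split.
- by rewrite unitrMl ?unitrV ?unitrX ?root_eval_unitX.
- by rewrite -horner_coef0.
- have Uxk : x n ^+ k \is a GRing.unit by rewrite unitrX ?root_eval_unitX.
  apply: (mulIr Uxk).
  by rewrite zE fE subr0 root_evalM root_evalX mulrAC divrK // mulrC.
Qed.

(** Normalised degrees are monotone for divisibility: at a common level the lift of [f] divides that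
    of [q] times a power of T, and is prime to T because its constant term is nonzero. *)
Lemma root_eval_dvd_size m n f q (z : D) :
    (n <= m)%N -> f`_0 != 0 -> q != 0 -> ev n f * z = ev m q ->
  ((size f).-1 * p ^ (m - n) <= (size q).-1)%N.
Proof.
move=> nm f0 q0 fzq; have [m0 Hz] := root_eval_ex z.
pose M := maxn m m0; have [e [l zE]] := Hz M (leq_maxr _ _).
have mM : (m <= M)%N := leq_maxl _ _; have nM := leq_trans nm mM.
pose f' := f \Po 'X^(p ^ (M - n)); pose q' := q \Po 'X^(p ^ (M - m)).
have E : f' * e = q' * 'X^l.
  apply: (@root_eval_inj M).
  by rewrite !root_evalM -!root_eval_lift // -zE mulrA fzq root_evalX.
have pM_gt0 k : (0 < p ^ k)%N by rewrite expn_gt0 p_gt0.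
have f'X : coprimep f' 'X^l.
  apply: coprimep_expr; rewrite -[X in coprimep _ X]subr0 -polyC0 coprimep_XsubC.
  by rewrite /root /f' horner_comp hornerXn expr0n gtn_eqF ?horner_coef0.
have f'q : f' %| q' by rewrite -(Gauss_dvdpl _ f'X) -E dvdp_mulr.
have q'0 : q' != 0 by rewrite /q' comp_poly_eq0 // size_polyXn ltnS.
have size_comp (g : {poly F}) k : (size (g \Po 'X^k)).-1 = ((size g).-1 * k)%N.
  by rewrite size_comp_poly size_polyXn.
have : ((size f').-1 <= (size q').-1)%N by rewrite -!subn1 leq_sub2r ?dvdp_leq.
rewrite !size_comp (_ : M - n = (m - n) + (M - m))%N; last by lia.
by rewrite expnD mulnA leq_pmul2r.
Qed.

Lemma root_eval_nonunit n f z : f`_0 != 0 -> (1 < size f)%N -> z * ev n f <> 1.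
Proof.
move=> f0 sf zf; have := @root_eval_dvd_size n n f 1 z (leqnn n) f0 (oner_neq0 _).
rewrite root_eval1 mulrC zf => /(_ erefl).
by rewrite subnn muln1 size_poly1 leqNgt; case: (size f) sf => [|[]].
Qed.

End RootRingTheory.

(** * Bezout property, dimension and residue fields of D *)

Section RootRingIdeals.
Variables (p : nat) (F L : fieldType) (iota : {rmorphism F -> L}).
Variables (X : nat -> L) (hX : compatible_roots p iota X).
Hypothesis p_prime : prime p.
Local Notation D := (root_ring hX).
Local Notation ev := (root_eval hX).
Local Notation x n := (ev n 'X).
Implicit Types (f g q : {poly F}) (z : D).

Lemma poly_gcd_bezout f g : exists d u w a b,
  [/\ d = u * f + w * g, f = a * d & g = b * d].
Proof.
have [[u w] /= E] := Bezoutp f g.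
have /dvdpP[a fE] : u * f + w * g %| f by rewrite (eqp_dvdl _ E) dvdp_gcdl.
have /dvdpP[b gE] : u * f + w * g %| g by rewrite (eqp_dvdl _ E) dvdp_gcdr.
by exists (u * f + w * g), u, w, a, b.
Qed.

(** Powers of X^(1/p^N) are units, so the Bezout identity of F[T] transfers from a common level. *)
Lemma root_ring_gcd (a b : D) : exists d u w a' b',
  [/\ d = u * a + w * b, a = a' * d & b = b' * d].
Proof.
have [m Ha] := root_eval_ex a; have [n Hb] := root_eval_ex b.
pose N := maxn m n; have [f [k aE]] := Ha N (leq_maxl _ _).
have [g [l bE]] := Hb N (leq_maxr _ _).
have Ux i : x N ^+ i \is a GRing.unit by rewrite unitrX ?root_eval_unitX.
have [d [u [w [a' [b' [dE fE gE]]]]]] := poly_gcd_bezout f g.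
exists (ev N d), (ev N u * x N ^+ k), (ev N w * x N ^+ l).
exists (ev N a' / x N ^+ k), (ev N b' / x N ^+ l); split.
- by rewrite dE root_evalD !root_evalM -aE -bE -!mulrA ![x N ^+ _ * _]mulrC.
- by apply: (mulIr (Ux k)); rewrite aE {1}fE root_evalM mulrAC divrK.
- by apply: (mulIr (Ux l)); rewrite bE {1}gE root_evalM mulrAC divrK.
Qed.

Lemma root_ring_bezout : bezout_domain D.
Proof.
move=> I _ [s Is]; rewrite /principal {}Is {I}.
elim: s => [|a s [b sb]].
  exists 0; apply/seteqP; split=> z.
    by move=> [c ->]; apply/generated_by1; exists 0; rewrite big_ord0 mul0r.
  by move=> /generated_by1[c ->]; exists (fun=> 0); rewrite big_ord0 mulr0.
have [d [u [w [a' [b' [dE aE bE]]]]]] := root_ring_gcd a b.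
exists d; apply/seteqP; split=> z.
  move=> /generated_by_cons[c [y [sy ->]]]; apply/generated_by1.
  move: sy; rewrite sb => /generated_by1[e ->].
  by exists (c * a' + e * b'); rewrite mulrDl -!mulrA -aE -bE.
move=> /generated_by1[c ->]; apply/generated_by_cons.
exists (c * u), (c * w * b); split; last by rewrite dE mulrDr !mulrA.
by rewrite sb; apply/generated_by1; exists (c * w).
Qed.

(** At a common level, let [r] be a nonzero polynomial of least degree in [P], and [d] its gcd with
    an [h] from [P'], so [r = e * d]. If [e] is in [P], minimality makes [d] a constant, hence a
    unit in [P'], which is absurd; so [d] is in [P], and [h] with it. *)
Lemma root_ring_prime_sub (P P' : pred D) : prime_ideal P -> prime_ideal P' ->
  (exists2 z, z \in P & z != 0) -> {subset P <= P'} -> {subset P' <= P}.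
Proof.
move=> [idP primeP] [idP' _] [z zP z0] PP' y yP'.
have [m Hz] := root_eval_ex z; have [n Hy] := root_eval_ex y.
pose N := maxn m n; have [f [k zE]] := Hz N (leq_maxl _ _).
have [h [l yE]] := Hy N (leq_maxr _ _).
have Ux i : x N ^+ i \is a GRing.unit by rewrite unitrX ?root_eval_unitX.
have xNP i : x N ^+ i \notin P.
  apply/negP => /(idealr_closed_mulr (x N ^+ i)^-1 idP).
  by rewrite mulVr //; case: idP => _ /negP.
have fP : ev N f \in P by rewrite -zE mulrC; apply: idealr_closed_mulr.
have f0 : f != 0.
  apply: contraNneq z0 => f0; apply/eqP/(mulIr (Ux k)).
  by rewrite zE f0 root_eval0 mul0r.
pose R s := `[< exists2 r : {poly F}, r != 0 & ev N r \in P /\ size r = s >].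
have [s /asboolP[r r0 [rP rs]] smin] : exists2 s, R s & forall t, R t -> (s <= t)%N.
  have exR : exists s, R s by exists (size f); apply/asboolP; exists f.
  by case: (ex_minnP exR) => s Rs least; exists s.
have {smin} rmin e : e != 0 -> ev N e \in P -> (size r <= size e)%N.
  by move=> e0 eP; rewrite rs; apply: smin; apply/asboolP; exists e.
have hP' : ev N h \in P' by rewrite -yE mulrC; apply: idealr_closed_mulr.
suff hP : ev N h \in P.
  have : (y \in P) || (x N ^+ l \in P) by apply: primeP; rewrite yE.
  by rewrite (negPf (xNP l)) orbF.
have [d [u [w [e [e' [dE rE hE]]]]]] := poly_gcd_bezout r h.
have dP' : ev N d \in P'.
  rewrite dE root_evalD !root_evalM; case: (idP') => _ _; apply.
    exact: PP'.
  exact: idealr_closed_mulr.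
have e0 : e != 0 by apply: contraNneq r0 => e0; rewrite rE e0 mul0r.
have d0 : d != 0 by apply: contraNneq r0 => d0; rewrite rE d0 mulr0.
have /orP[eP|dP] : (ev N e \in P) || (ev N d \in P).
  by apply: primeP; rewrite -root_evalM -rE.
- have := rmin e e0 eP; rewrite {1}rE size_mul // => le.
  have /size_poly1P[c c0 dc] : size d == 1%N.
    move: le e0 d0; rewrite -!size_poly_gt0; move: (size d) (size e) => i j.
    by clear; lia.
  case: (idP') => _ /negP n1 _; case: n1; move: dP'; rewrite dc => dP'.
  rewrite -(mulVr (root_eval_unitC hX N c0)).
  exact: idealr_closed_mulr.
- by rewrite hE root_evalM; apply: idealr_closed_mulr.
Qed.

Lemma Xn_sub1_coef0 k : (0 < k)%N -> ('X^k - 1 : {poly F})`_0 != 0.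
Proof. by move=> k0; rewrite coefB coefXn coef1 ltn_eqF // sub0r oppr_eq0 oner_eq0. Qed.

Lemma X_sub1_nonunit n z : z * ev n ('X - 1) <> 1.
Proof.
apply: root_eval_nonunit => //; first by rewrite -(expr1 'X) Xn_sub1_coef0.
by rewrite -polyC1 size_XsubC.
Qed.

Lemma X_sub1_neq0 n : ev n ('X - 1) != 0.
Proof.
apply/eqP; rewrite -(root_eval0 hX n) => /root_eval_inj/eqP.
by rewrite -polyC1 polyXsubC_eq0.
Qed.

(** A maximal ideal containing X - 1 lies above 0. Conversely, of two distinct comparable primes one
    is 0. *)
Lemma root_ring_krull_dim : krull_dim_eq D `I_1.
Proof.
pose Z : pred D := pred1 0.
have Z_prime : prime_ideal Z.
  split; first split=> //; rewrite ?inE ?oner_eq0 //.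
    by move=> a u w; rewrite !inE => /eqP-> /eqP->; rewrite mulr0 addr0.
  by move=> u w; rewrite !inE mulf_eq0.
have sub_Z (P P' : pred D) : prime_ideal P -> prime_ideal P' ->
    {subset P <= P'} -> P <> P' -> P = Z.
  move=> Pp P'p PP' neq; have [nz|nz] := pselect (exists2 z, z \in P & z != 0).
    case: neq; apply/funext => z; apply/idP/idP; first exact: PP'.
    exact: root_ring_prime_sub.
  have P0 : 0 \in P by case: Pp => -[].
  apply/funext => z; apply/idP/idP => [zP|/eqP->//].
  by apply/eqP; apply: contrapT => /eqP z0; apply: nz; exists z.
split.
  have [M maxM xM] := maximal_ideal_exists (@X_sub1_nonunit 0).
  have MZ : M <> Z.
    by move=> MZ; move: xM; rewrite MZ inE; apply/negP/X_sub1_neq0.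
  exists [set Z; M].
    split; first by exists Z; left.
      by move=> _ [->|->] //; apply: maximal_ideal_prime.
    have ZM : {subset Z <= M} by move=> z /eqP->; case: maxM => -[].
    by move=> _ _ [->|->] [->|->]; [left|left|right|left].
  exists Z; first by left.
  rewrite (_ : [set Z; M] `\ Z = [set M]) ?card_set1 //.
  apply/seteqP; split=> [P [[PZ nPZ|->//]]|P ->]; first by case: nPZ.
  by split=> //; right.
move=> C U beta [_ Cp Ctot] [P CP Cbeta].
have CZ P1 P2 : C P1 -> C P2 -> P1 <> P2 -> P1 = Z \/ P2 = Z.
  move=> C1 C2 neq; have [s|s] := Ctot _ _ C1 C2; [left|right].
    by apply: (sub_Z _ _ _ _ s) => //; apply: Cp.
  by apply: (sub_Z _ _ _ _ s) => //; [apply: Cp|apply: Cp|apply/nesym].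
have : C `\ P #<= `I_1.
  (* The constant map is injective here: [P] and two further members would be three distinct primes,
     any two of them including 0. *)
  apply: (@injection_card_le _ _ _ _ (fun=> 0%N)) => //.
  move=> R S; rewrite !inE => -[CR RP] [CS SP] _; apply: contrapT => RS.
  have [PZ|RZ] := CZ _ _ CP CR (nesym RP).
    by have [|] := CZ _ _ CR CS RS; rewrite -PZ.
  by have [|] := CZ _ _ CP CS (nesym SP); rewrite -RZ // => /nesym.
by rewrite (card_le_eql Cbeta).
Qed.

Lemma X_sub1_dvd m n : (m <= n)%N -> exists h, ev m ('X - 1) = h * ev n ('X - 1).
Proof.
move=> mn; rewrite (root_eval_lift _ _ mn) comp_polyB comp_polyX.
rewrite -polyC1 comp_polyC polyC1.
by rewrite subrX1 root_evalM mulrC; eexists.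
Qed.

(** Finitely many elements of the ideal are multiples of a single X^(1/p^n) - 1. If they generated
    it, X^(1/p^(n+1)) - 1 would be such a multiple, and normalised degrees would give p <= 1. *)
Lemma root_ring_not_noetherian : ~ noetherian D.
Proof.
pose I : pred D := fun z => `[< exists n h, z = h * ev n ('X - 1) >].
have IE z : z \in I <-> exists n h, z = h * ev n ('X - 1).
  by split=> [/asboolP|?]; last exact/asboolP.
have up m n h : (m <= n)%N -> exists h', h * ev m ('X - 1) = h' * ev n ('X - 1).
  by move=> /X_sub1_dvd[e ->]; exists (h * e); rewrite mulrA.
have join z w m n h h' : z = h * ev m ('X - 1) -> w = h' * ev n ('X - 1) ->
    forall a, exists e, a * z + w = e * ev (maxn m n) ('X - 1).
  move=> -> -> a; have [e ->] := up _ _ h (leq_maxl m n).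
  have [e' ->] := up _ _ h' (leq_maxr m n).
  by exists (a * e + e'); rewrite mulrDl mulrA.
have idI : is_ideal I.
  split; first by apply/IE; exists 0%N, 0; rewrite mul0r.
  move=> a u w /IE[m [h uE]] /IE[n [h' wE]]; apply/IE.
  by exists (maxn m n); apply: join uE wE a.
move=> /(_ I idI)[s Is].
have [n Hn] : exists n, forall z, generated_by s z -> exists h, z = h * ev n ('X - 1).
  have : forall z, generated_by s z -> z \in I by move=> z; rewrite -Is.
  elim: s {Is} => [|a s IH] sI.
    by exists 0%N => z [c ->]; exists 0; rewrite big_ord0 mul0r.
  have [|n Hn] := IH.
    move=> z sz; apply: sI; apply/generated_by_cons; exists 0, z.
    by rewrite mul0r add0r.
  have /IE[m [h aE]] : a \in I.
    apply: sI; apply/generated_by_cons; exists 1, 0; rewrite mul1r addr0; split=> //.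
    by exists (fun=> 0); rewrite big1 // => i _; rewrite mul0r.
  exists (maxn m n) => z /generated_by_cons[c [y [/Hn[h' yE] ->]]].
  exact: join aE yE c.
have [|h hE] := Hn (ev n.+1 ('X - 1)).
  by rewrite -Is; apply/IE; exists n.+1, 1; rewrite mul1r.
have := @root_eval_dvd_size _ _ _ _ _ hX p_prime n.+1 n ('X - 1) ('X - 1)
  h (leqnSn n).
rewrite -[in X in X`_0](expr1 'X) Xn_sub1_coef0 // -polyC1 polyXsubC_eq0 size_XsubC.
rewrite polyC1 mulrC -hE => /(_ isT isT erefl).
by rewrite subSnn mul1n expn1 leqNgt prime_gt1.
Qed.

(** Distinct constants differ by a unit, so F embeds in D/M. If [a] generated M, it would divide
    some X^(k/p^m) - 1 with k at most |D/M| for every m, so its positive normalised degree would be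
    arbitrarily small. *)
Lemma root_ring_finite_residue (M : idealr D) : maximal_ideal M ->
  finite_set [set: {ideal_quot M}] -> finite_set [set: F] /\ ~ principal M.
Proof.
move=> maxM /finite_setP[c cM].
have [idM _] := maxM.
pose pi z : {ideal_quot M} := (\pi_{ideal_quot M} z)%qT.
have piE z w : pi z = pi w -> z - w \in M.
  by move=> /eqP; rewrite -Quotient.idealrBE.
have M1 : 1 \notin M by case: idM.
have MU u : u \is a GRing.unit -> u \notin M.
  by move=> Uu; apply: contraNN M1 => uM; rewrite -(mulVr Uu); apply: idealr_closed_mulr.
split.
  apply: (@card_le_finite _ _ _ [set: {ideal_quot M}]); last first.
    by apply/finite_setP; exists c.
  apply: (@injection_card_le _ _ _ _ (fun a => pi (ev 0%N a%:P))) => // a b _ _.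
  move=> /piE; rewrite -root_evalB -polyCB => abM; apply/eqP; rewrite -subr_eq0.
  by apply: contraTT abM => ab; apply: MU; apply: root_eval_unitC.
move=> [a Ma].
have aM z : z \in M -> exists h, z = h * a.
  by move=> zM; have : [set` M] z by []; rewrite Ma => /generated_by1.
(* Pigeonhole: two of the [c.+1] first powers of X^(1/p^m) agree in the residue field, which has [c]
   elements. *)
have xk m : exists2 k, (0 < k <= c)%N & ev m ('X^k - 1) \in M.
  apply: contrapT => nex.
  suff : `I_c.+1 #<= `I_c by rewrite card_le_II ltnn.
  rewrite -(card_le_eqr cM).
  apply: (@injection_card_le _ _ _ _ (fun i => pi (x m ^+ i))) => // i j.
  rewrite !inE /= !ltnS.
  wlog ij : i j / (i <= j)%N.
    move=> H ic jc E; have [/H->//|/ltnW/H] := leqP i j.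
    by move=> /(_ jc ic (esym E)).
  move=> _ jc /esym/piE xM; apply/eqP; rewrite eqn_leq ij /= leqNgt.
  apply/negP => lt_ij; apply: nex; exists (j - i)%N.
    by rewrite subn_gt0 lt_ij (leq_trans (leq_subr _ _)).
  rewrite root_evalB root_evalX root_eval1.
  rewrite (_ : _ - 1 = x m ^- i * (x m ^+ j - x m ^+ i)).
    exact: idealr_closed_mulr.
  have Uxi : x m ^+ i \is a GRing.unit by rewrite unitrX ?root_eval_unitX.
  by rewrite mulrBr mulVr // -{2}(subnKC ij) exprD mulKr.
have a0 : a != 0.
  apply/eqP => a0; have [k /andP[k0 _] /aM[h]] := xk 0%N.
  rewrite a0 mulr0 -(root_eval0 hX 0%N) => /root_eval_inj/eqP.
  by apply/negP; apply: contraNneq (Xn_sub1_coef0 k0) => ->; rewrite coef0.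
have [n [f [u [Uu f0 aE]]]] := root_eval_associate a0.
have sf : (1 < size f)%N.
  rewrite ltnNge; apply/negP => /size1_polyC fC.
  suff : a \notin M.
    apply/negP/negPn; suff : [set` M] a by [].
    by rewrite Ma; apply/generated_by1; exists 1; rewrite mul1r.
  by apply: MU; rewrite aE unitrM Uu fC root_eval_unitC.
(* At level [n + c], divisibility by [f] forces [p ^ c <= k <= c]. *)
have [k /andP[k0 kc] /aM[h hE]] := xk (n + c)%N.
have := @root_eval_dvd_size _ _ _ _ _ hX p_prime (n + c) n f ('X^k - 1)
  (h * u) (leq_addr _ _) f0.
rewrite mulrC -mulrA -aE -hE => /(_ _ erefl).
have k1 : ('X^k - 1 : {poly F}) != 0.
  by apply: contraNneq (Xn_sub1_coef0 k0) => ->; rewrite coef0.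
rewrite addKn size_XnsubC // => /(_ k1) /= le_k.
have : (p ^ c <= c)%N.
  by apply: leq_trans kc; apply: leq_trans le_k; rewrite leq_pmull // -subn1 subn_gt0.
by rewrite leqNgt ltn_expl ?prime_gt1.
Qed.
End RootRingIdeals.

(** * Valuations of D *)

(** This is the trivial valuation of the residue domain, pulled back so as to be infinite on [P]. *)
Lemma prime_valuation (A : comNzRingType) (P : pred A) :
  prime_ideal P -> valuation (fun a => a \notin P) (fun=> 0).
Proof.
move=> [idP primeP]; have [P0 P1 Plin] := idP; split=> //.
- by rewrite P0.
- move=> a b; split=> [abP|[aP bP]].
    split; apply: contraNN abP; last exact: idealr_closed_mulr.
    by rewrite mulrC; apply: idealr_closed_mulr.
  by apply/negP => /primeP; rewrite (negPf aP) (negPf bP).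
- move=> a b abP; have [aP|] := boolP (a \in P); [right|by left].
  split=> //; apply: contraNN abP => bP.
  by rewrite -[a]mul1r Plin.
Qed.

Lemma valuation_scale (A : comNzRingType) (Q : A -> Prop) (v : A -> rat) (c : rat) :
  0 <= c -> valuation Q v -> valuation Q (fun a => c * v a).
Proof.
move=> c0 [v0 Q0 Q1 QM vM vD]; split=> //.
- by move=> a Qa; rewrite mulr_ge0 ?v0.
- by move=> a b Qa Qb; rewrite vM // mulrDr.
- by move=> a b /vD[] [Qa le]; [left|right]; rewrite ler_wpM2l.
Qed.

Section RootRingSeries.
Variables (p : nat) (F L : fieldType) (iota : {rmorphism F -> L}).
Variables (X : nat -> L) (hX : compatible_roots p iota X).
Hypothesis p_prime : prime p.
Local Notation D := (root_ring hX).
Local Notation ev := (root_eval hX).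
Local Notation x n := (ev n 'X).
Implicit Types (f g q : {poly F}) (z w : D).

(* The valuations are trivial on the residue fields at the roots of
   [(T^p - 1)/(T - 1)], for [T = X^(1/p^(k+1))]: there [X^(1/p^j) - 1] vanishes
   exactly for [j <= k]. *)
Lemma root_series_dim_pchar' (W : Type) : p%:R != 0 :> F -> card_aleph1 W ->
  krull_dim_ge (power_series D) [set: set W].
Proof.
move=> p0 aW; pose Phi : {poly F} := \sum_(i < p) 'X^i.
have PhiE : 'X^p - 1 = ('X - 1) * Phi by rewrite subrX1.
have Phi1 : Phi.[1] = p%:R.
  rewrite horner_sum (eq_bigr (fun=> 1)) => [|i _]; last by rewrite hornerXn expr1n.
  by rewrite sumr_const card_ord.
have sPhi : size Phi = p.
  have := size_XnsubC (1 : F) (prime_gt0 p_prime); rewrite polyC1 PhiE.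
  have [->|Phi0] := eqVneq Phi 0; first by rewrite mulr0 size_poly0.
  by rewrite size_mul ?polyXsubC_eq0 -?polyC1 ?polyXsubC_eq0 // size_XsubC; case.
have Phi_coef0 : Phi`_0 != 0.
  have := Xn_sub1_coef0 F (prime_gt0 p_prime).
  by rewrite PhiE -!horner_coef0 hornerM mulf_eq0 => /norP[].
(* [Phi] has positive degree and nonzero constant term, hence is a nonunit at level [k.+1]. *)
have /choice[M HM] k : exists M : pred D, maximal_ideal M /\ ev k.+1 Phi \in M.
  have [|M maxM PhiM] := @maximal_ideal_exists D (ev k.+1 Phi).
    by move=> z; apply: root_eval_nonunit; rewrite // sPhi prime_gt1.
  by exists M.
have idM k : idealr_closed (M k) by case: (HM k) => -[].
have in_M j k : (j <= k)%N -> ev j ('X - 1) \in M k.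
  move=> /(X_sub1_dvd hX)[h ->]; apply: idealr_closed_mulr => //.
  rewrite (root_eval_lift hX _ (leqnSn k)) subSnn expn1 comp_polyB comp_polyX.
  rewrite -polyC1 comp_polyC polyC1 PhiE root_evalM; apply: idealr_closed_mulr => //.
  by case: (HM k).
have notin_M j k : (k < j)%N -> ev j ('X - 1) \notin M k.
  move=> kj; apply/negP => Mj.
  have Mk1 : ev k.+1 ('X - 1) \in M k.
    by have [h ->] := X_sub1_dvd hX kj; apply: idealr_closed_mulr.
  (* Modulo T - 1, [Phi] is the constant p; an ideal containing both T - 1 and [Phi] contains the
     unit p. *)
  have /factor_theorem[q qE] : root (Phi - p%:R%:P) 1.
    by rewrite /root hornerD hornerN hornerC Phi1 subrr.
  have pE : p%:R%:P = Phi - q * ('X - 1%:P) by rewrite -qE opprB addrC subrK.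
  have : ev k.+1 (p%:R%:P) \in M k.
    rewrite pE root_evalB root_evalM polyC1 addrC -mulNr.
    by case: (idM k) => _ _; apply=> //; case: (HM k).
  have U := root_eval_unitC hX k.+1 p0.
  move=> /(idealr_closed_mulr (ev k.+1 p%:R%:P)^-1 (idM k)); rewrite mulVr //.
  by apply/negP; case: (idM k).
apply: (@power_series_krull_dim_ge D (fun k z => z \notin M k) (fun=> fun=> 0)
  (fun j => ev j ('X - 1))) => //.
- by move=> k; apply/prime_valuation/maximal_ideal_prime; case: (HM k).
- by move=> j k jk; rewrite in_M.
- by move=> j k kj; split=> //; apply: notin_M.
Qed.

End RootRingSeries.

(** * The order of vanishing at 1 in characteristic p *)

Section PcharValuation.
Variables (p : nat) (F L : fieldType) (iota : {rmorphism F -> L}).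
Variables (X : nat -> L) (hX : compatible_roots p iota X).
Hypothesis p_prime : prime p.
Hypothesis p_pchar : p \in [pchar F].
Local Notation D := (root_ring hX).
Local Notation ev := (root_eval hX).
Local Notation x n := (ev n 'X).
Implicit Types (f g q : {poly F}) (z w : D).

(** In characteristic p, T^(p^a) - 1 = (T - 1)^(p^a), while the lifted cofactor stays nonzero at
    1. *)
Lemma mup1_comp_Xn f a : f != 0 -> mup 1 (f \Po 'X^(p ^ a)) = (p ^ a * mup 1 f)%N.
Proof.
move=> f0; have [m [q q0 fE]] := multiplicity_XsubC f 1; rewrite f0 /= in q0.
have q_nz : q != 0 by apply: contraNneq q0 => ->; rewrite root0.
have Xp : 'X^(p ^ a) - 1 = ('X - 1%:P) ^+ (p ^ a) :> {poly F}.
  have p_poly : p \in [pchar {poly F}] by rewrite pchar_poly.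
  have p_nat : [pchar {poly F}].-nat (p ^ a)%N.
    by rewrite (eq_pnat _ (pcharf_eq p_poly)) pnatX pnat_id.
  by rewrite polyC1 exprDn_pchar // exprNn_pchar // expr1n.
have comp_q : ~~ root (q \Po 'X^(p ^ a)) 1.
  by rewrite /root horner_comp hornerXn expr1n.
have XN0 k : ('X - 1%:P) ^+ k != 0 :> {poly F} by rewrite expf_neq0 ?polyXsubC_eq0.
rewrite {1}fE comp_polyM rmorphXn /= comp_polyB comp_polyX comp_polyC polyC1 Xp.
rewrite -exprM mupMr // mup_XsubCX eqxx; congr (_ * _)%N.
by rewrite fE mupMr // mup_XsubCX eqxx.
Qed.

Lemma mup1_mulXn f k : mup 1 (f * 'X^k) = mup 1 f.
Proof. by rewrite mupMl // /root hornerXn expr1n oner_eq0. Qed.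

(* The order of vanishing at 1, normalised to take the value 1 at [X 0 - 1]. *)
Definition root_order z : rat :=
  xget 0 [set t | exists n f k, z * x n ^+ k = ev n f /\ t = (mup 1 f)%:R / (p ^ n)%:R].

Let pX_gt0 n : (0 : rat) < (p ^ n)%:R.
Proof. by rewrite ltr0n expn_gt0 prime_gt0. Qed.

Let ev_neq0 z n f k : z != 0 -> z * x n ^+ k = ev n f -> f != 0.
Proof.
move=> z0 zE; apply: contraNneq z0 => f0; move/eqP: zE; rewrite f0 root_eval0.
have Ux := root_eval_unitX hX n.
by rewrite mulf_eq0 expf_eq0 => /orP[//|/andP[_ /eqP xn0]]; rewrite xn0 unitr0 in Ux.
Qed.

(** Two representations are compared at a common level [N]: lifting multiplies the order by a power
    of p that the normalisation cancels, and powers of T have order 0 at 1. *)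
Lemma root_orderE z n f k : z != 0 -> z * x n ^+ k = ev n f ->
  root_order z = (mup 1 f)%:R / (p ^ n)%:R.
Proof.
move=> z0 zf; rewrite /root_order.
case: xgetP => [t _ [m [g [l [zg ->]]]]|]; last first.
  by move=> /(_ ((mup 1 f)%:R / (p ^ n)%:R)) []; exists n, f, k.
have f0 := ev_neq0 z0 zf; have g0 := ev_neq0 z0 zg.
pose N := maxn m n.
have nN : (n <= N)%N := leq_maxr _ _; have mN : (m <= N)%N := leq_maxl _ _.
have E : ((f \Po 'X^(p ^ (N - n))) * 'X^(p ^ (N - m) * l))%R =
         ((g \Po 'X^(p ^ (N - m))) * 'X^(p ^ (N - n) * k))%R.
  have xN i j : (i <= N)%N -> ev N 'X^(p ^ (N - i) * j) = x i ^+ j.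
    by move=> iN; rewrite (root_eval_lift hX 'X iN) comp_polyX -root_evalX exprM.
  apply: (@root_eval_inj _ _ _ _ _ hX N).
  by rewrite !root_evalM -!root_eval_lift // !xN // -zf -zg mulrAC.
move: E => /(congr1 (mup 1)); rewrite !mup1_mulXn !mup1_comp_Xn //.
move=> /(congr1 (fun i => i%:R : rat)); rewrite !natrM => E.
have divE i (r : rat) : (i <= N)%N ->
    r / (p ^ i)%:R = (p ^ (N - i))%:R * r / (p ^ N)%:R.
  move=> iN; rewrite -(subnK iN) expnD natrM subnK // -mulf_div divff ?mul1r //.
  by rewrite gt_eqF.
by rewrite (divE m) // (divE n) // E.
Qed.

Lemma root_order_valuation : valuation (fun z => z != 0) root_order.
Proof.
split=> //.
- move=> z z0; have [n [f [k zE]]] := root_eval_surj z.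
  by rewrite (root_orderE z0 zE) divr_ge0 ?ler0n.
- by rewrite eqxx.
- exact: oner_neq0.
- by move=> z w; rewrite mulf_eq0 negb_or; split=> [/andP//|[-> ->]].
- move=> z w z0 w0; have [m Hz] := root_eval_ex z; have [n Hw] := root_eval_ex w.
  have [f [k zE]] := Hz (maxn m n) (leq_maxl _ _).
  have [g [l wE]] := Hw (maxn m n) (leq_maxr _ _).
  have zwE : z * w * x (maxn m n) ^+ (k + l) = ev (maxn m n) (f * g).
    by rewrite root_evalM -zE -wE exprD mulrACA.
  rewrite (root_orderE z0 zE) (root_orderE w0 wE) (root_orderE _ zwE) ?mulf_neq0 //.
  by rewrite mupM ?(ev_neq0 z0 zE) ?(ev_neq0 w0 wE) // natrD mulrDl.
- move=> z w zw0; have [zE|z0] := eqVneq z 0; first by rewrite zE add0r in zw0 *; right.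
  have [wE|w0] := eqVneq w 0; first by rewrite wE addr0 in zw0 *; left.
  have [m Hz] := root_eval_ex z; have [n Hw] := root_eval_ex w.
  set N := maxn m n.
  have [f [k zE]] := Hz N (leq_maxl _ _); have [g [l wE]] := Hw N (leq_maxr _ _).
  have zwE : (z + w) * x N ^+ (k + l) = ev N (f * 'X^l + g * 'X^k).
    by rewrite root_evalD !root_evalM !root_evalX -zE -wE mulrDl exprD !mulrA
      [w * x N ^+ k * _]mulrAC.
  rewrite (root_orderE z0 zE) (root_orderE w0 wE) (root_orderE zw0 zwE).
  have f0 := ev_neq0 z0 zE; have g0 := ev_neq0 w0 wE; have h0 := ev_neq0 zw0 zwE.
  rewrite !ler_pM2r ?invr_gt0 // !ler_nat.
  have : (minn (mup 1 f) (mup 1 g) <= mup 1 (f * 'X^l + g * 'X^k))%N.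
    rewrite mup_geq // dvdp_add // dvdp_mulr // -mup_geq //.
      exact: geq_minl.
    exact: geq_minr.
  by rewrite geq_min => /orP[]; [left|right].
Qed.

Lemma root_orderX_sub1 n : root_order (ev n ('X - 1)) = (p ^ n)%:R^-1.
Proof.
have E : ev n ('X - 1) * x n ^+ 0 = ev n ('X - 1) by rewrite expr0 mulr1.
rewrite (root_orderE (X_sub1_neq0 hX n) E).
by rewrite -polyC1 (mup_XsubCX 1) eqxx mul1r.
Qed.

(* Rescaled by [k p^(k^2)], the order of [X (j^2) - 1] is at least [k] for
   [j <= k] and at most 1 for [j > k]. *)
Lemma root_series_dim_pchar (W : Type) : card_aleph1 W ->
  krull_dim_ge (power_series D) [set: set W].
Proof.
move=> aW.
pose c k : rat := k%:R * (p ^ (k ^ 2))%:R.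
apply: (@power_series_krull_dim_ge D (fun k z => z != 0) (fun k z => c k * root_order z)
  (fun j => ev (j ^ 2) ('X - 1))) => //.
- move=> k; apply: valuation_scale root_order_valuation.
  by rewrite mulr_ge0 ?ler0n.
- move=> j k jk _; rewrite root_orderX_sub1 /c -mulrA ler_peMr ?ler0n //.
  by rewrite ler_pdivlMr // mul1r ler_nat leq_exp2l ?prime_gt1 // leq_exp2r.
- move=> j k kj; split; first exact: X_sub1_neq0.
  rewrite root_orderX_sub1 /c ler_pdivrMr // mul1r -natrM ler_nat.
  (* The squares in the exponents leave a spare factor [p ^ k], which absorbs the [k] in [c k]. *)
  have le_sq : (k + k ^ 2 <= j ^ 2)%N by nia.
  apply: leq_trans (leq_pexp2l (prime_gt0 p_prime) le_sq).
  by rewrite expnD leq_mul2r ltnW ?orbT // ltn_expl ?prime_gt1.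
Qed.

End PcharValuation.

(** * The upper bound *)

(** An element is determined by a level, a numerator and the exponent of the denominator. *)
Lemma root_ring_countable (p : nat) (F L : fieldType) (iota : {rmorphism F -> L})
    (X : nat -> L) (hX : compatible_roots p iota X) : prime p ->
  countable [set: F] -> countable [set: root_ring hX].
Proof.
move=> p_prime /countable_injP[i i_inj].
have /choice[c Hc] (z : root_ring hX) : exists c : nat * {poly F} * nat,
    z * root_eval hX c.1.1 'X ^+ c.2 = root_eval hX c.1.1 c.1.2.
  by have [n [f [k zE]]] := root_eval_surj z; exists (n, f, k).
apply: (@sub_countable _ _ _ [set: nat * seq nat * nat]); last exact: countableP.
apply: (@injection_card_le _ _ _ _
  (fun z => ((c z).1.1, map i (c z).1.2, (c z).2))) => // z w _ _ E.
have cE : c z = c w.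
  case: (c z) (c w) E => [[n f] k] [[m g] l] /= [-> fg ->]; congr (_, _, _).
  by apply/val_inj/(inj_map (f := i)) => // a b; apply: i_inj; rewrite inE.
have := Hc z; rewrite cE -(Hc w); apply: mulIr.
by rewrite unitrX ?root_eval_unitX.
Qed.

(** A series is coded by the graph of its coefficient sequence. *)
Lemma power_series_card_le (A : comNzRingType) : countable [set: A] ->
  [set: power_series A] #<= [set: set nat].
Proof.
move=> /countable_injP[i i_inj].
apply: (@injection_card_le _ _ _ _
  (fun f => range (fun n => pickle (n, i (series_coef f n))))) => // f g _ _ fg.
apply: power_seriesP => n; apply: i_inj; rewrite ?inE //.
have : range (fun n => pickle (n, i (series_coef f n)))
    (pickle (n, i (series_coef f n))).
  by exists n.
rewrite fg => -[m _ /(pcan_inj pickleK)[-> <-]] //.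
Qed.

Lemma krull_dim_eq_card (A : comNzRingType) (T : Type) :
    [set: pred A] #<= [set: T] -> krull_dim_ge A [set: T] ->
  krull_dim_eq A [set: T].
Proof.
move=> AT [C chC [U [beta [[P CP Pbeta] Tbeta]]]].
have le_T (E : set (pred A)) : E #<= [set: T].
  by apply: card_le_trans AT; apply: subset_card_le.
split.
  exists C => //; exists P => //; apply: Cantor_Bernstein; first exact: le_T.
  by rewrite (card_le_eqr Pbeta).
by move=> E V gamma _ [R _ Egamma]; rewrite -(card_le_eql Egamma).
Qed.

Theorem proposition3p1 (p : nat) (p_prime : prime p) (F L : fieldType)
    (iota : {rmorphism F -> L}) (X : nat -> L)
    (hX : compatible_roots p iota X) :
  [/\ (* (1) *)
      bezout_domain (root_ring hX) /\ krull_dim_eq (root_ring hX) `I_1,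
      (* (2) *)
      ~ dedekind_domain (root_ring hX),
      (* (3) *)
      forall M : idealr (root_ring hX), maximal_ideal M ->
        finite_set [set: {ideal_quot M}] ->
        finite_set [set: F] /\ ~ principal M
    & (* (4) *)
      forall W : Type, card_aleph1 W ->
        krull_dim_ge (power_series (root_ring hX)) [set: set W] /\
        (continuum_hypothesis -> countable [set: F] ->
         krull_dim_eq (power_series (root_ring hX)) [set: set W])].
Proof.
have ge W : card_aleph1 W -> krull_dim_ge (power_series (root_ring hX)) [set: set W].
  (* If p is nonzero in F, trivial valuations at maximal ideals serve; otherwise F has
     characteristic p and the rescaled order at 1 does. *)
  have [p0|p0] := eqVneq (p%:R : F) 0; last exact: root_series_dim_pchar'.
  by apply: root_series_dim_pchar => //; apply/andP; split=> //; apply/eqP.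
split.
- by split; [apply: root_ring_bezout|apply: root_ring_krull_dim].
- by move=> [noeth _ _]; apply: (root_ring_not_noetherian p_prime noeth).
- by move=> M; apply: root_ring_finite_residue.
- move=> W aW; split; first exact: ge.
  (* Now [set nat] and [W] both have cardinality aleph_1, so D[[Y]] has at most |W| elements and at
     most 2^|W| subsets, prime ideals or not. *)
  move=> CH cF; apply: krull_dim_eq_card (ge W aW).
  have leW : [set: power_series (root_ring hX)] #<= [set: W].
    have := aleph1_card_eq CH aW; rewrite card_eq_le => /andP[le _].
    apply: card_le_trans le; apply: power_series_card_le.
    exact: root_ring_countable.
  apply: card_le_trans (card_le_set leW).
  apply: (@injection_card_le _ _ _ _ (fun P => [set` P])) => // P P' _ _ PP'.
  apply/funext => f; apply/idP/idP => fP.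
    by have : [set` P'] f by rewrite -PP'.
  by have : [set` P] f by rewrite PP'.
Qed.
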